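(* For each term $t\in T$, put $\Delta(t)=(t,\Delta_t,\phi(t))$. Then $\mathcal{LD}^+$ is a left-Garside category with left-Garside map $\Delta$, and $[\pi,\mathrm{ht}]$ is a surjective right-lcm preserving functor of $\mathcal{LD}^+$ onto the positive braid category $\mathcal{B}^+$.
   Context: **Left-Garside categories.** Composition is written left to right: $fg$ means ''$f$ then $g$''; $\partial_0 f$ and $\partial_1 f$ are the source and target of $f$; $1_x$ is the identity at $x$; a morphism is nontrivial if it is not an identity. Write $f\preccurlyeq g$ ($f$ left-divides $g$) if $fh=g$ for some $h$, and $f\prec g$ if moreover $h$ can be chosen nontrivial; $\mathrm{Div}(f)$ is the collection of left-divisors of $f$. A right-lcm of $f,g$ is a common right-multiple $h$ ($f\preccurlyeq h$, $g\preccurlyeq h$) with $h\preccurlyeq h'$ for every common right-multiple $h'$. A category is left-preGarside if: (LG0) for each morphism $f$, every $\prec$-increasing sequence $f_1\prec f_2\prec\cdots$ in $\mathrm{Div}(f)$ is finite; (LG1) $fg=fg'$ implies $g=g'$; (LG2) any two morphisms that admit a common right-multiple admit a right-lcm. A left-Garside map is a map $\Delta$ from objects to morphisms such that, for each object $x$, $\partial_0\Delta(x)=x$ and (LG3) every nontrivial morphism with source $x$ has a nontrivial left-divisor lying in $\mathrm{Div}(\Delta(x))$, and $f\preccurlyeq\Delta(x)$ implies $\Delta(x)\preccurlyeq f\,\Delta(\partial_1 f)$. A left-Garside category is a left-preGarside category possessing a left-Garside map. **Terms and self-distributivity.** $T$ is the set of terms, i.e. of all bracketed expressions built from variables $x_1,x_2,\dots$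 with a binary operation $\star$, viewed as rooted binary trees. $\mathbb{A}$ is the set of addresses (finite sequences of $0$'s and $1$'s), $\epsilon$ the empty address; $t_{/\alpha}$ is the subterm of $t$ at address $\alpha$, if it exists ($t_{/\epsilon}=t$, $(t_0\star t_1)_{/0\alpha}=(t_0)_{/\alpha}$, $(t_0\star t_1)_{/1\alpha}=(t_1)_{/\alpha}$). For $\alpha\in\mathbb{A}$, $t\bullet D_\alpha$ is defined iff $t_{/\alpha}$ exists and has the form $t_1\star(t_2\star t_3)$, and then it is the term obtained from $t$ by replacing this subterm by $(t_1\star t_2)\star(t_1\star t_3)$. $\mathrm{LD}^+$ is the monoid generated by $\{D_\alpha\mid\alpha\in\mathbb{A}\}$ subject to the following relations, for all $\alpha,\beta,\gamma\in\mathbb{A}$: $D_{\alpha0\beta}D_{\alpha1\gamma}=D_{\alpha1\gamma}D_{\alpha0\beta}$; $D_{\alpha0\beta}D_\alpha=D_\alpha D_{\alpha00\beta}D_{\alpha10\beta}$; $D_{\alpha10\beta}D_\alpha=D_\alpha D_{\alpha01\beta}$; $D_{\alpha11\beta}D_\alpha=D_\alpha D_{\alpha11\beta}$; $D_\alpha D_{\alpha1}D_\alpha=D_{\alpha1}D_\alpha D_{\alpha1}D_{\alpha0}$. The partial maps $t\mapsto t\bullet D_\alpha$ induce (by successive application, left to right) a well-defined partial right action of $\mathrm{LD}^+$ on $T$, written $t\bullet a$. $\mathcal{LD}^+$ is the category whose objects are terms and whose morphisms are triples $(t,a,t')$ with $a\in\mathrm{LD}^+$, $t\bullet a$ defined and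 $t\bullet a=t'$ (source $t$, target $t'$; $(t,a,t')(t',b,t'')=(t,ab,t'')$). **The elements $\Delta_t$.** Operations on terms: $t\circledast x_i=t\star x_i$, $t\circledast(t_1\star t_2)=(t\circledast t_1)\star(t\circledast t_2)$; $\phi(x_i)=x_i$, $\phi(t_1\star t_2)=\phi(t_1)\circledast\phi(t_2)$. For an address $\gamma$, $\mathrm{sh}_\gamma$ is the endomorphism of $\mathrm{LD}^+$ mapping $D_\alpha$ to $D_{\gamma\alpha}$. Define $\delta_t=\Delta_t=1$ for $t$ a variable, and, for $t=t_0\star t_1$, $\delta_t=D_\epsilon\cdot\mathrm{sh}_0(\delta_{t_0})\cdot\mathrm{sh}_1(\delta_{t_1})$ and $\Delta_t=\mathrm{sh}_0(\Delta_{t_0})\cdot\mathrm{sh}_1(\Delta_{t_1})\cdot\delta_{\phi(t_1)}$. One has $t\bullet\Delta_t=\phi(t)$. **Braids.** $B_n^+$ ($n\le\infty$) is the monoid generated by $\sigma_1,\dots,\sigma_{n-1}$ with relations $\sigma_i\sigma_j=\sigma_j\sigma_i$ for $|i-j|\ge2$ and $\sigma_i\sigma_j\sigma_i=\sigma_j\sigma_i\sigma_j$ for $|i-j|=1$; $B_0^+=B_1^+=\{1\}$; $B_n^+$ is viewed as a submonoid of $B_\infty^+$. $\mathcal{B}^+$ is the category whose objects are the nonnegative integers and whose morphisms are the triples $(n,a,n)$ with $a\in B_n^+$, composed by multiplying the middle entries. The right-height is $\mathrm{ht}(x_i)=0$, $\mathrm{ht}(t_0\star t_1)=\mathrm{ht}(t_1)+1$.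 $\pi:\mathrm{LD}^+\to B_\infty^+$ is the monoid homomorphism with $\pi(D_\alpha)=\sigma_{i+1}$ if $\alpha=1^i$ ($i\ge0$ times the letter $1$) and $\pi(D_\alpha)=1$ otherwise. $[\pi,\mathrm{ht}]$ maps the object $t$ to $\mathrm{ht}(t)$ and the morphism $(t,a,t')$ to $(\mathrm{ht}(t),\pi(a),\mathrm{ht}(t'))$. A functor is right-lcm preserving if it maps a right-lcm of two morphisms to a right-lcm of their images. *)

(* Defs.v *)
From HB Require Import structures.
From mathcomp Require Import all_boot boolp.

Set Implicit Arguments.
Unset Strict Implicit.
Unset Printing Implicit Defensive.

Local Open Scope quotient_scope.
Local Open Scope group_scope.

(* [mcomp f g] is "f then g". *)
Record category := Category {
  Ob :> Type;
  Hom : Ob -> Ob -> Type;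
  idm : forall x, Hom x x;
  mcomp : forall x y z, Hom x y -> Hom y z -> Hom x z;
  comp1m : forall x y (f : Hom x y), mcomp (idm x) f = f;
  compm1 : forall x y (f : Hom x y), mcomp f (idm y) = f;
  compA : forall x y z w (f : Hom x y) (g : Hom y z) (h : Hom z w),
    mcomp f (mcomp g h) = mcomp (mcomp f g) h }.

Arguments Hom {c} x y.
Arguments idm {c} x.
Arguments mcomp {c x y z} f g.

Record functor (C D : category) := Functor {
  fob :> C -> D;
  fmor : forall x y : C, Hom x y -> Hom (fob x) (fob y);
  fmor1 : forall x : C, fmor (idm x) = idm (fob x);
  fmorM : forall (x y z : C) (f : Hom x y) (g : Hom y z),
    fmor (mcomp f g) = mcomp (fmor f) (fmor g) }.

Arguments fmor {C D} F {x y} f : rename.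

(* A morphism packed with its source and target, so that morphisms of
   different hom-sets can be compared. *)
Definition mor (C : category) := {xy : C * C & Hom xy.1 xy.2}.

Definition pack (C : category) (x y : C) (f : Hom x y) : mor C :=
  existT (fun xy : C * C => Hom xy.1 xy.2) (x, y) f.

Definition surjective_functor (C D : category) (F : functor C D) : Prop :=
  (forall y : D, exists x : C, F x = y) /\
  (forall (y y' : D) (g : Hom y y'),
     exists (x x' : C) (f : Hom x x'), pack (fmor F f) = pack g).

Section Garside.
Variable C : category.

Inductive is_identity : forall x y : C, Hom x y -> Prop :=
  IsIdentity x : is_identity (idm x).

Definition nontrivial (x y : C) (f : Hom x y) : Prop := ~ is_identity f.

(* Divisibility only makes sense between morphisms with the same source. *)
Definition ldiv (x y z : C) (f : Hom x y) (g : Hom x z) : Prop :=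
  exists h : Hom y z, mcomp f h = g.

Definition sldiv (x y z : C) (f : Hom x y) (g : Hom x z) : Prop :=
  exists h : Hom y z, nontrivial h /\ mcomp f h = g.

Definition common_right_multiple (x y z w : C)
    (f : Hom x y) (g : Hom x z) (h : Hom x w) : Prop :=
  ldiv f h /\ ldiv g h.

Definition right_lcm (x y z w : C)
    (f : Hom x y) (g : Hom x z) (h : Hom x w) : Prop :=
  common_right_multiple f g h /\
  (forall (w' : C) (h' : Hom x w'), common_right_multiple f g h' -> ldiv h h').

Definition LG0 : Prop :=
  forall (x y : C) (f : Hom x y),
    ~ exists (z : nat -> C) (g : forall n, Hom x (z n)),
        (forall n, ldiv (g n) f) /\ (forall n, sldiv (g n) (g n.+1)).

Definition LG1 : Prop :=
  forall (x y z : C) (f : Hom x y) (g g' : Hom y z),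
    mcomp f g = mcomp f g' -> g = g'.

Definition LG2 : Prop :=
  forall (x y z : C) (f : Hom x y) (g : Hom x z),
    (exists (w : C) (h : Hom x w), common_right_multiple f g h) ->
    exists (w : C) (h : Hom x w), right_lcm f g h.

Definition left_preGarside : Prop := [/\ LG0, LG1 & LG2].

(* A map [Delta] from objects to morphisms with [Delta x] of source [x] is
   given together with the map [tgt] sending [x] to the target of [Delta x]. *)
Definition left_Garside_map (tgt : C -> C) (Delta : forall x, Hom x (tgt x))
    : Prop :=
  (forall (x y : C) (f : Hom x y), nontrivial f ->
     exists (z : C) (g : Hom x z),
       [/\ nontrivial g, ldiv g f & ldiv g (Delta x)]) /\
  (forall (x y : C) (f : Hom x y),
     ldiv f (Delta x) -> ldiv (Delta x) (mcomp f (Delta y))).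

Definition left_Garside : Prop :=
  left_preGarside /\
  exists (tgt : C -> C) (Delta : forall x, Hom x (tgt x)),
    left_Garside_map Delta.

End Garside.

Definition right_lcm_preserving (C D : category) (F : functor C D) : Prop :=
  forall (x y z w : C) (f : Hom x y) (g : Hom x z) (h : Hom x w),
    right_lcm f g h -> right_lcm (fmor F f) (fmor F g) (fmor F h).

Section Presentation.
Variables (A : choiceType) (R : seq A -> seq A -> Prop).

Inductive cong : seq A -> seq A -> Prop :=
| cong_refl u : cong u u
| cong_sym u v : cong u v -> cong v u
| cong_trans u v w : cong u v -> cong v w -> cong u w
| cong_rel u l r v : R l r -> cong (u ++ l ++ v) (u ++ r ++ v).

Definition congb : rel (seq A) := fun u v => `[< cong u v >].

Lemma congb_refl : reflexive congb.
Proof. by move=> u; apply/asboolP; apply: cong_refl. Qed.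

Lemma congb_sym : symmetric congb.
Proof. by move=> u v; apply/asboolP/asboolP; apply: cong_sym. Qed.

Lemma congb_trans : transitive congb.
Proof.
move=> v u w /asboolP uv /asboolP vw; apply/asboolP; exact: cong_trans uv vw.
Qed.

Canonical congb_equiv := EquivRel congb congb_refl congb_sym congb_trans.

Definition presented := {eq_quot congb_equiv}.
HB.instance Definition _ := Choice.on presented.

Definition pword (w : seq A) : presented := \pi w.

Lemma pwordP u v : pword u = pword v <-> cong u v.
Proof.
split; first by move/eqP; rewrite /pword piE => /asboolP.
by move=> uv; apply/eqP; rewrite /pword piE; apply/asboolP.
Qed.

Lemma pword_rel l r : R l r -> pword l = pword r.
Proof.
by move=> lr; apply/pwordP; have:= cong_rel [::] [::] lr; rewrite /= !cats0.
Qed.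

Lemma pword_repr x : pword (repr x) = x.
Proof. exact: reprK. Qed.

Lemma cong_cat u u' v v' : cong u u' -> cong v v' -> cong (u ++ v) (u' ++ v').
Proof.
move=> uu' vv'; apply: (@cong_trans _ (u' ++ v)).
  elim: uu' => [x|x y _|x y z _ xy _|x l r y lr].
  - exact: cong_refl.
  - exact: cong_sym.
  - exact: cong_trans.
  - by rewrite -!catA; apply: cong_rel.
elim: vv' => [x|x y _|x y z _ xy _|x l r y lr].
- exact: cong_refl.
- exact: cong_sym.
- exact: cong_trans.
- by have E w : u' ++ x ++ w ++ y = (u' ++ x) ++ w ++ y; [rewrite catA | rewrite !E; apply: cong_rel].
Qed.

Definition pmul (x y : presented) : presented := pword (repr x ++ repr y).
Definition pone : presented := pword [::].

Lemma pmul_word u v : pmul (pword u) (pword v) = pword (u ++ v).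
Proof.
by apply/pwordP; apply: cong_cat; apply/pwordP; rewrite pword_repr.
Qed.

Lemma pmulA : associative pmul.
Proof.
move=> x y z; rewrite -[x]pword_repr -[y]pword_repr -[z]pword_repr.
by rewrite !pmul_word catA.
Qed.

Lemma pmul1x : left_id pone pmul.
Proof. by move=> x; rewrite -[x]pword_repr pmul_word. Qed.

Lemma pmulx1 : right_id pone pmul.
Proof. by move=> x; rewrite -[x]pword_repr pmul_word cats0. Qed.

HB.instance Definition _ := isMonoid.Build presented pmulA pmul1x pmulx1.

Lemma pwordM u v : pword (u ++ v) = pword u * pword v.
Proof. by rewrite -pmul_word. Qed.

Definition pgen (a : A) : presented := pword [:: a].

(* The monoid homomorphism extending [f]; it is one only when [f] respects
   the relations, see [plift_word]. *)
Definition plift (M : monoidType) (f : A -> M) (x : presented) : M :=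
  \prod_(a <- repr x) f a.

Definition respects (M : monoidType) (f : A -> M) : Prop :=
  forall l r, R l r -> \prod_(a <- l) f a = \prod_(a <- r) f a.

Lemma cong_invariant (T : Type) (f : seq A -> T) :
  (forall u l r v, R l r -> f (u ++ l ++ v) = f (u ++ r ++ v)) ->
  forall u v, cong u v -> f u = f v.
Proof.
move=> fR u v; elim=> {u v} [//|u v _ //|u v w _ -> _ //|u l r v lr].
exact: fR.
Qed.

Section Lift.
Variables (M : monoidType) (f : A -> M).
Hypothesis fR : respects f.

Lemma plift_word w : plift f (pword w) = \prod_(a <- w) f a.
Proof.
apply: (cong_invariant (f := fun w => \prod_(a <- w) f a)).
  by move=> u l r v /fR lr; rewrite !big_cat /= lr.
by apply/pwordP; rewrite pword_repr.
Qed.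

Lemma plift_gen a : plift f (pgen a) = f a.
Proof. by rewrite plift_word big_seq1. Qed.

Lemma plift_is_morphism : monoid_morphism (plift f).
Proof.
split=> [|x y]; first by rewrite -[1]/(pword [::]) plift_word big_nil.
rewrite -[x]pword_repr -[y]pword_repr -pwordM !plift_word.
by rewrite big_cat.
Qed.

End Lift.
End Presentation.

(* [Var i] is the variable x_(i+1). *)
Inductive term := Var (i : nat) | Star (t0 t1 : term).

Lemma term_comparable : comparable term.
Proof.
by move=> s t; rewrite /decidable; decide equality; apply: eq_comparable.
Qed.

HB.instance Definition _ := hasDecEq.Build term (compareP term_comparable).

(* Addresses: [false] is the letter 0 and [true] the letter 1. *)
Definition address := seq bool.

Fixpoint subterm (t : term) (a : address) : option term :=
  match a, t with
  | [::], _ => Some t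
  | false :: a', Star t0 _ => subterm t0 a'
  | true :: a', Star _ t1 => subterm t1 a'
  | _ :: _, Var _ => None
  end.

(* [replace t a s] is [t] if there is no subterm of [t] at [a]. *)
Fixpoint replace (t : term) (a : address) (s : term) : term :=
  match a, t with
  | [::], _ => s
  | false :: a', Star t0 t1 => Star (replace t0 a' s) t1
  | true :: a', Star t0 t1 => Star t0 (replace t1 a' s)
  | _ :: _, Var _ => t
  end.

Definition actD (t : term) (a : address) : option term :=
  match subterm t a with
  | Some (Star t1 (Star t2 t3)) =>
      Some (replace t a (Star (Star t1 t2) (Star t1 t3)))
  | _ => None
  end.

Fixpoint circ (t s : term) : term :=
  match s with
  | Var _ => Star t s
  | Star s1 s2 => Star (circ t s1) (circ t s2)
  end.

Fixpoint phi (t : term) : term :=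
  match t with
  | Var _ => t
  | Star t1 t2 => circ (phi t1) (phi t2)
  end.

Fixpoint ht (t : term) : nat :=
  match t with
  | Var _ => 0
  | Star _ t1 => (ht t1).+1
  end.

Inductive LD_rel : seq address -> seq address -> Prop :=
| LD_rel_perp (a b c : address) :
    LD_rel [:: a ++ false :: b; a ++ true :: c]
           [:: a ++ true :: c; a ++ false :: b]
| LD_rel_0 (a b : address) :
    LD_rel [:: a ++ false :: b; a]
           [:: a; a ++ false :: false :: b; a ++ true :: false :: b]
| LD_rel_10 (a b : address) :
    LD_rel [:: a ++ true :: false :: b; a]
           [:: a; a ++ false :: true :: b]
| LD_rel_11 (a b : address) :
    LD_rel [:: a ++ true :: true :: b; a]
           [:: a; a ++ true :: true :: b]
| LD_rel_1 (a : address) :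
    LD_rel [:: a; a ++ [:: true]; a]
           [:: a ++ [:: true]; a; a ++ [:: true]; a ++ [:: false]].

Definition LDmon := presented LD_rel.

Definition Dgen (a : address) : LDmon := pgen LD_rel a.

Definition actw (t : term) (w : seq address) : option term :=
  foldl (fun o a => obind (actD^~ a) o) (Some t) w.

(* The value does not depend on the chosen word, see [act_word]. *)
Definition act (t : term) (x : LDmon) : option term := actw t (repr x).

Lemma actw_None w :
  foldl (fun o a => obind (actD^~ a) o) None w = None :> option term.
Proof. by elim: w. Qed.

Lemma actw_cons t a w : actw t (a :: w) = obind (actw^~ w) (actD t a).
Proof. by rewrite /actw /=; case: (actD t a) => //=; rewrite actw_None. Qed.

Lemma actw_cat t u v : actw t (u ++ v) = obind (actw^~ v) (actw t u).
Proof.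
elim: u t => [|a u IH] t //=.
by rewrite !actw_cons; case: (actD t a) => [s|] //=; rewrite IH.
Qed.

Lemma actD_Var i a : actD (Var i) a = None.
Proof. by case: a => [|[] a]. Qed.

Lemma actD_Star0 t0 t1 a :
  actD (Star t0 t1) (false :: a) = omap (Star^~ t1) (actD t0 a).
Proof.
by rewrite /actD /=; case: (subterm t0 a) => [[i|s1 [i|s2 s3]]|].
Qed.

Lemma actD_Star1 t0 t1 a :
  actD (Star t0 t1) (true :: a) = omap (Star t0) (actD t1 a).
Proof.
by rewrite /actD /=; case: (subterm t1 a) => [[i|s1 [i|s2 s3]]|].
Qed.

Lemma actw_Var i b w : actw (Var i) (map (cons b) w) =
  if w is [::] then Some (Var i) else None.
Proof. by case: w => [//|a w] /=; rewrite actw_cons actD_Var. Qed.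

Lemma actw_Star0 t0 t1 w :
  actw (Star t0 t1) (map (cons false) w) = omap (Star^~ t1) (actw t0 w).
Proof.
elim: w t0 => [//|a w IH] t0 /=; rewrite !actw_cons actD_Star0.
by case: (actD t0 a) => //= s; rewrite IH.
Qed.

Lemma actw_Star1 t0 t1 w :
  actw (Star t0 t1) (map (cons true) w) = omap (Star t0) (actw t1 w).
Proof.
elim: w t1 => [//|a w IH] t1 /=; rewrite !actw_cons actD_Star1.
by case: (actD t1 a) => //= s; rewrite IH.
Qed.

Lemma actw_prefix a l r : size l != 0 -> size r != 0 ->
  (forall t, actw t l = actw t r) ->
  forall t, actw t (map (cat a) l) = actw t (map (cat a) r).
Proof.
move=> l0 r0 lr; elim: a => [|b a IH] t; first by rewrite !map_id.
have cons_cat w : map (cat (b :: a)) w = map (cons b) (map (cat a) w).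
  by rewrite -map_comp.
rewrite !cons_cat.
case: t => [i|t0 t1]; first by rewrite !actw_Var; case: (l) (r) l0 r0 => [|??] [|??].
by case: b {cons_cat}; rewrite ?actw_Star0 ?actw_Star1 IH.
Qed.

Lemma actw_rel l r : LD_rel l r -> forall t, actw t l = actw t r.
Proof.
case=> [a b c|a b|a b|a b|a].
- apply: (@actw_prefix a [:: false :: b; true :: c] [:: true :: c; false :: b]) => //.
  move=> [i|t0 t1]; rewrite !actw_cons ?actD_Var // actD_Star0 actD_Star1.
  case E0: (actD t0 b) => [s0|]; case E1: (actD t1 c) => [s1|] //=;
  by rewrite ?actw_cons ?actD_Star0 ?actD_Star1 ?E0 ?E1.
- rewrite -{2 3}[a]cats0.
  apply: (@actw_prefix a [:: false :: b; [::]]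
    [:: [::]; [:: false, false & b]; [:: true, false & b]]) => //.
  move=> [i|t0 [i|t1 t2]]; rewrite !actw_cons ?actD_Var // actD_Star0.
    by case: (actD t0 b).
  rewrite {2}/actD /= !actw_cons !actD_Star0.
  by case E: (actD t0 b) => [s|] //=; rewrite !actw_cons actD_Star1 actD_Star0 E.
- rewrite -{2 3}[a]cats0.
  apply: (@actw_prefix a [:: [:: true, false & b]; [::]]
    [:: [::]; [:: false, true & b]]) => //.
  move=> [i|t0 [i|t1 t2]]; rewrite !actw_cons ?actD_Var // actD_Star1.
  rewrite {2}/actD /= !actw_cons !actD_Star0 !actD_Star1.
  by case E: (actD t1 b).
- rewrite -{2 3}[a]cats0.
  apply: (@actw_prefix a [:: [:: true, true & b]; [::]]
    [:: [::]; [:: true, true & b]]) => //.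
  move=> [i|t0 [i|t1 t2]]; rewrite !actw_cons ?actD_Var // actD_Star1.
  rewrite {2}/actD /= !actw_cons !actD_Star1.
  by case E: (actD t2 b).
- rewrite -{1 3 5}[a]cats0.
  apply: (@actw_prefix a [:: [::]; [:: true]; [::]]
    [:: [:: true]; [::]; [:: true]; [:: false]]) => //.
  by move=> [i|t0 [i|t1 [i|t2 t3]]].
Qed.

Lemma act_word t w : act t (pword LD_rel w) = actw t w.
Proof.
apply: (cong_invariant (R := LD_rel)); last by apply/pwordP; rewrite pword_repr.
move=> u l r v lr; rewrite !actw_cat; case: (actw t u) => //= s.
by rewrite !actw_cat (actw_rel lr).
Qed.

Lemma act1 t : act t 1 = Some t.
Proof. by rewrite -[1]/(pword LD_rel [::]) act_word. Qed.

Lemma actM t (x y : LDmon) : act t (x * y) = obind (act^~ y) (act t x).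
Proof.
rewrite -[x in LHS]pword_repr -[y in LHS]pword_repr.
by rewrite -[_ * _](pwordM LD_rel) act_word actw_cat.
Qed.

Lemma act_D t a : act t (Dgen a) = actD t a.
Proof. by rewrite /Dgen /pgen act_word. Qed.

Definition LDhom (t t' : term) := {x : LDmon | act t x == Some t'}.

Definition LDid t : LDhom t t := exist _ 1 (introT eqP (act1 t)).

Lemma LDcomp_subproof t t' t'' (f : LDhom t t') (g : LDhom t' t'') :
  act t (val f * val g) == Some t''.
Proof. by rewrite actM (eqP (valP f)) /= (eqP (valP g)). Qed.

Definition LDcomp t t' t'' (f : LDhom t t') (g : LDhom t' t'') : LDhom t t'' :=
  exist _ (val f * val g) (LDcomp_subproof f g).

Lemma LDcomp1m t t' (f : LDhom t t') : LDcomp (LDid t) f = f.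
Proof. by apply: val_inj; rewrite /= mul1g. Qed.

Lemma LDcompm1 t t' (f : LDhom t t') : LDcomp f (LDid t') = f.
Proof. by apply: val_inj; rewrite /= mulg1. Qed.

Lemma LDcompA t1 t2 t3 t4
    (f : LDhom t1 t2) (g : LDhom t2 t3) (h : LDhom t3 t4) :
  LDcomp f (LDcomp g h) = LDcomp (LDcomp f g) h.
Proof. by apply: val_inj; rewrite /= mulgA. Qed.

Definition LDcat : category := Category LDcomp1m LDcompm1 LDcompA.

(* The middle entry of a morphism (t, a, t'). *)
Definition LDmid (t t' : term) (f : LDhom t t') : LDmon := val f.

Definition sh (c : address) : LDmon -> LDmon := plift (fun a => Dgen (c ++ a)).

Lemma prod_gen (A : choiceType) (R : seq A -> seq A -> Prop) B (f : B -> A) w :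
  \prod_(b <- w) pgen R (f b) = pword R (map f w).
Proof.
elim: w => [|b w IH]; first by rewrite big_nil.
by rewrite big_cons IH /= -[f b :: _]/([:: f b] ++ _) pwordM.
Qed.

Lemma sh_respects c : respects LD_rel (fun a => Dgen (c ++ a)).
Proof.
move=> l r lr; rewrite !prod_gen; apply: pword_rel.
by case: lr => * /=; rewrite !catA; constructor.
Qed.

HB.instance Definition _ c :=
  isUMagmaMorphism.Build LDmon LDmon (sh c) (plift_is_morphism (sh_respects c)).

Lemma sh_word c w : sh c (pword LD_rel w) = pword LD_rel (map (cat c) w).
Proof. by rewrite /sh plift_word ?prod_gen //; exact: sh_respects. Qed.

Lemma sh_D c a : sh c (Dgen a) = Dgen (c ++ a).
Proof. by rewrite /Dgen /pgen sh_word. Qed.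

Fixpoint delta (t : term) : LDmon :=
  match t with
  | Var _ => 1
  | Star t0 t1 => Dgen [::] * sh [:: false] (delta t0) * sh [:: true] (delta t1)
  end.

Fixpoint Delta (t : term) : LDmon :=
  match t with
  | Var _ => 1
  | Star t0 t1 =>
      sh [:: false] (Delta t0) * sh [:: true] (Delta t1) * delta (phi t1)
  end.

Lemma act_sh0 t0 t1 x :
  act (Star t0 t1) (sh [:: false] x) = omap (Star^~ t1) (act t0 x).
Proof. by rewrite -[x]pword_repr sh_word !act_word actw_Star0. Qed.

Lemma act_sh1 t0 t1 x :
  act (Star t0 t1) (sh [:: true] x) = omap (Star t0) (act t1 x).
Proof. by rewrite -[x]pword_repr sh_word !act_word actw_Star1. Qed.

Lemma act_delta s t : act (Star s t) (delta t) = Some (circ s t).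
Proof.
elim: t s => [i|t0 IH0 t1 IH1] s /=; first exact: act1.
by rewrite !actM act_D /= act_sh0 IH0 /= act_sh1 IH1.
Qed.

Lemma act_Delta t : act t (Delta t) = Some (phi t).
Proof.
elim: t => [i|t0 IH0 t1 IH1] /=; first exact: act1.
by rewrite !actM act_sh0 IH0 /= act_sh1 IH1 /= act_delta.
Qed.

Definition LDDelta (t : LDcat) : @Hom LDcat t (phi t) :=
  exist _ (Delta t) (introT eqP (act_Delta t)).

(* Braid relations on a set [I] of generators, the generator [i] standing for
   sigma_((idx i) + 1). *)
Inductive braid_rel (I : Type) (idx : I -> nat) : seq I -> seq I -> Prop :=
| braid_comm i j : (idx i + 2 <= idx j) || (idx j + 2 <= idx i) ->
    braid_rel idx [:: i; j] [:: j; i]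
| braid_braid i j : (idx j == (idx i).+1) || (idx i == (idx j).+1) ->
    braid_rel idx [:: i; j; i] [:: j; i; j].

(* [Bpos 0] and [Bpos 1] have no generator. *)
Definition Bpos (n : nat) := presented (braid_rel (@nat_of_ord n.-1)).

Definition Binf := presented (braid_rel (fun i : nat => i)).

(* [sigma i] is the generator usually written sigma_(i+1). *)
Definition sigma (i : nat) : Binf := pgen (braid_rel (fun i : nat => i)) i.

Definition Bincl (n : nat) : Bpos n -> Binf :=
  plift (fun i : 'I_n.-1 => sigma i).

Lemma Bincl_respects n :
  respects (braid_rel (@nat_of_ord n.-1)) (fun i : 'I_n.-1 => sigma i).
Proof.
move=> l r lr; rewrite !prod_gen; apply: pword_rel.
by case: lr => * /=; constructor.
Qed.

HB.instance Definition _ n :=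
  isUMagmaMorphism.Build (Bpos n) Binf (@Bincl n)
    (plift_is_morphism (@Bincl_respects n)).

(* [b] belongs to B_n^+, viewed as a submonoid of B_oo^+. *)
Definition inB (n : nat) (b : Binf) : Prop := exists a : Bpos n, Bincl a = b.

Lemma inB1 n : inB n 1.
Proof. by exists 1; rewrite gmulf1. Qed.

Lemma inBM n b c : inB n b -> inB n c -> inB n (b * c).
Proof. by case=> x <- [y <-]; exists (x * y); rewrite gmulfM. Qed.

Definition Bhom (n m : nat) := {b : Binf | (n == m) && `[< inB n b >]}.

Lemma Bid_subproof n : (n == n) && `[< inB n 1 >].
Proof. by rewrite eqxx; apply/asboolP; apply: inB1. Qed.

Definition Bid n : Bhom n n := exist _ 1 (Bid_subproof n).

Lemma Bcomp_subproof n m p (f : Bhom n m) (g : Bhom m p) :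
  (n == p) && `[< inB n (val f * val g) >].
Proof.
case: f g => [b /= /andP[/eqP <- /asboolP nb]] [c /= /andP[/eqP <- /asboolP nc]].
by rewrite eqxx; apply/asboolP; apply: inBM.
Qed.

Definition Bcomp n m p (f : Bhom n m) (g : Bhom m p) : Bhom n p :=
  exist _ (val f * val g) (Bcomp_subproof f g).

Lemma Bcomp1m n m (f : Bhom n m) : Bcomp (Bid n) f = f.
Proof. by apply: val_inj; rewrite /= mul1g. Qed.

Lemma Bcompm1 n m (f : Bhom n m) : Bcomp f (Bid m) = f.
Proof. by apply: val_inj; rewrite /= mulg1. Qed.

Lemma BcompA n m p q (f : Bhom n m) (g : Bhom m p) (h : Bhom p q) :
  Bcomp f (Bcomp g h) = Bcomp (Bcomp f g) h.
Proof. by apply: val_inj; rewrite /= mulgA. Qed.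

Definition Bcat : category := Category Bcomp1m Bcompm1 BcompA.

Definition Bmid (n m : nat) (f : Bhom n m) : Binf := val f.

Definition piD (a : address) : Binf := if all id a then sigma (size a) else 1.

Definition piLD : LDmon -> Binf := plift piD.

Lemma sigma_comm i j : i + 2 <= j -> sigma i * sigma j = sigma j * sigma i.
Proof.
move=> ij; rewrite -!pwordM; apply: pword_rel.
by apply: braid_comm; rewrite ij.
Qed.

Lemma sigma_braid i :
  sigma i * sigma i.+1 * sigma i = sigma i.+1 * sigma i * sigma i.+1.
Proof.
have E a b c : sigma a * sigma b * sigma c = pword _ [:: a; b; c].
  by rewrite -[[:: a; b; c]]/([:: a] ++ [:: b] ++ [:: c]) !pwordM mulgA.
by rewrite !E; apply/pword_rel/braid_braid; rewrite eqxx.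
Qed.

Lemma piD_respects : respects LD_rel piD.
Proof.
move=> l r [a b c|a b|a b|a b|a];
  rewrite !(big_cons, big_nil) !mulg1 /piD ?all_cat ?size_cat /= ?andbT ?andbF
    ?mul1g ?mulg1 //.
  case: (all id a) => //=; rewrite ?mul1g ?mulg1 //.
  case: (all id b) => //=; rewrite ?mul1g ?mulg1 //.
  by rewrite -sigma_comm // leq_add2l.
case: (all id a) => //=; rewrite ?mul1g ?mulg1 //.
by rewrite addn1 !mulgA sigma_braid.
Qed.

HB.instance Definition _ :=
  isUMagmaMorphism.Build LDmon Binf piLD (plift_is_morphism piD_respects).

Lemma piLD_D a : piLD (Dgen a) = piD a.
Proof. exact: plift_gen piD_respects a. Qed.

(* Main.v *)
Require Import Defs.
From mathcomp Require Import all_boot boolp zify.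

(* For any two distinct addresses a, b exactly one defining relation has the
   form D_a ... = D_b ...; write D_a (a\b) = D_b (b\a).  Since applying D_a
   enlarges a term, induction on the size of terms is available, and left
   cancellation together with the existence of right-lcms, computed by tiling
   grids with these generator squares, follows from the cube condition on
   triples of addresses.  That condition is local: it is inherited under a
   common prefix, commutation disposes of addresses on different sides of the
   root, and only triples containing the empty address need a computation.
   The homomorphism pi maps generator squares of LD+ to generator squares of
   braids, hence tiled grids to tiled grids; so the braid monoid inherits the
   cube condition from LD+, and right-lcms are preserved.
   For the left-Garside map it suffices to treat a generator D_a acting on t,
   sending it to t': by induction on t, D_a divides Delta_t and Delta_t divides
   D_a Delta_t'.  The case a = 0... uses sh_0(x) delta_t = delta_t y, the case
   a = 1... uses sh_1(x) delta_t' = delta_t x when t.x = t', and the case of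
   the empty address uses moreover that delta_t divides delta_(circ s t). *)

Set Implicit Arguments.
Unset Strict Implicit.
Unset Printing Implicit Defensive.

Local Open Scope group_scope.

(** * Complemented presentations *)

Lemma pword_cons (A : choiceType) (R : seq A -> seq A -> Prop) a w :
  pword R (a :: w) = pgen R a * pword R w.
Proof. exact: (pwordM R [:: a] w). Qed.

Lemma pword_ind (A : choiceType) (R : seq A -> seq A -> Prop)
    (P : presented R -> Prop) :
  P 1 -> (forall a x, P x -> P (pgen R a * x)) -> forall x, P x.
Proof.
move=> P1 PM x; rewrite -[x]pword_repr; elim: (repr x) => [//|a w IH].
by rewrite pword_cons; apply: PM.
Qed.

Section Complement.
Variables (A : choiceType) (R : seq A -> seq A -> Prop).
Local Notation M := (presented R).
Local Notation g := (pgen R).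
Variable C : A -> A -> M.

(** A rectangle tiled by generator squares: [x] and [y] leave a common corner, [x'] is opposite to
    [x] and [y'] opposite to [y]. Edges are elements of the monoid, not words, so relations may be
    applied along an edge between two tiles. *)
Inductive grid : M -> M -> M -> M -> Prop :=
| grid_1l y : grid 1 y 1 y
| grid_1r x : grid x 1 x 1
| grid_gen a b : grid (g a) (g b) (C b a) (C a b)
| grid_Ml x1 x2 y x1' x2' y1 y2 :
    grid x1 y x1' y1 -> grid x2 y1 x2' y2 ->
    grid (x1 * x2) y (x1' * x2') y2
| grid_Mr x y1 y2 x1 x2 y1' y2' :
    grid x y1 x1 y1' -> grid x1 y2 x2 y2' ->
    grid x (y1 * y2) x2 (y1' * y2').

Lemma grid_sym x y x' y' : grid x y x' y' -> grid y x y' x'.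
Proof.
elim=> {x y x' y'}; [exact: grid_1r | exact: grid_1l | | |].
- by move=> a b; apply: grid_gen.
- by move=> *; apply: grid_Mr; eassumption.
- by move=> *; apply: grid_Ml; eassumption.
Qed.

(* The three faces of a cube that are opposite to the common source of
   [a], [b], [c]; the faces through that source are generator squares. *)
Definition cube (a b c : A) : Prop := exists u v w : M,
  [/\ grid (C c a) (C c b) v u, grid (C a b) (C a c) u w
    & grid (C b a) (C b c) v w].

Lemma cube_swap12 a b c : cube a b c -> cube b a c.
Proof. by move=> [u [v [w [*]]]]; exists v, u, w; split=> //; exact: grid_sym. Qed.

Lemma cube_swap13 a b c : cube a b c -> cube c b a.
Proof.
by move=> [u [v [w [*]]]]; exists u, w, v; split; exact: grid_sym.
Qed.

Hypothesis CR : forall l r, R l r -> exists a b u v,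
  [/\ l = a :: u, r = b :: v, pword R u = C a b & pword R v = C b a].
Hypothesis Cxx : forall a, C a a = 1.
Hypothesis Csquare : forall a b, g a * C a b = g b * C b a.

Lemma grid_mul x y x' y' : grid x y x' y' -> x * y' = y * x'.
Proof.
elim=> {x y x' y'} [y|x|a b|x1 x2 y x1' x2' y1 y2 _ E1 _ E2
  |x y1 y2 x1 x2 y1' y2' _ E1 _ E2]; rewrite ?mulg1 ?mul1g //.
- by rewrite -mulgA E2 !mulgA E1.
- by rewrite mulgA E1 -!mulgA E2.
Qed.

Lemma grid_xx x : grid x x 1 1.
Proof.
elim/pword_ind: x => [|a x IH]; first exact: grid_1l.
have Gaa : grid (g a) (g a) 1 1 by have:= grid_gen a a; rewrite Cxx.
have Gax := grid_Mr Gaa (grid_1l x); rewrite mul1g in Gax.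
by have:= grid_Ml Gax IH; rewrite mulg1.
Qed.

Lemma cube_xx a c : cube a a c.
Proof.
by exists 1, 1, (C a c); split; rewrite ?Cxx; [exact: grid_xx | exact: grid_1l..].
Qed.

(* [bnd x n] bounds the length of the words representing [x]. *)
Variable bnd : M -> nat -> Prop.
Hypothesis bndM : forall x y n, bnd (x * y) n -> bnd y n.
Hypothesis bnd_gen0 : forall a y, ~ bnd (g a * y) 0.
Hypothesis bnd_genS : forall a y n, bnd (g a * y) n.+1 -> bnd y n.
Hypothesis cubeP : forall a b c, cube a b c.

Definition gen_lcm_upto n := forall a b p q, g a * p = g b * q ->
  bnd (g a * p) n -> exists r, p = C a b * r /\ q = C b a * r.

(** The lcm property propagates through the tiling: factoring through one tile leaves an equation
    for the adjacent tile, and the bound passes to right factors. *)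
Lemma grid_lcm_upto n x y x' y' : gen_lcm_upto n -> grid x y x' y' ->
  forall p q, x * p = y * q -> bnd (x * p) n ->
  exists r, p = y' * r /\ q = x' * r.
Proof.
move=> Pn; elim=> {x y x' y'} [y|x|a b|x1 x2 y x1' x2' y1 y2 _ IH1 _ IH2
  |x y1 y2 x1 x2 y1' y2' _ IH1 _ IH2] p q.
- by rewrite mul1g => -> _; exists q; rewrite mul1g.
- by rewrite mul1g => <- _; exists p; rewrite mul1g.
- exact: Pn.
- rewrite -mulgA => E B; have [r [E1 ->]] := IH1 _ _ E B.
  have [s [-> ->]] := IH2 _ _ E1 (bndM B).
  by exists s; rewrite mulgA.
- rewrite -mulgA => E B; have [r [-> E1]] := IH1 _ _ E B.
  rewrite E in B; have [s [-> ->]] := IH2 _ _ (esym E1) ltac:(rewrite -E1; exact: bndM B).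
  by exists s; rewrite mulgA.
Qed.

(** Induction on the bound, then on a derivation between the two words. Transitivity is the hard
    case and the place where the cube condition enters. Taking [a = b] gives left cancellation of a
    generator, since [C a a = 1]. *)
Lemma gen_lcm n : gen_lcm_upto n.
Proof.
elim: n => [|n IHn] a b p q E B; first by case: (bnd_gen0 B).
have key w w' : cong R w w' -> bnd (pword R w) n.+1 ->
    (w = [::] /\ w' = [::]) \/ exists a u b v r, [/\ w = a :: u, w' = b :: v,
       pword R u = C a b * r & pword R v = C b a * r].
  elim=> {w w' a b p q E B} [[|a u]|w w' ww' IH|w1 w2 w3 w12 IH12 w23 IH23
    |[|a u] l r v lr] B.
  - by left.
  - by right; exists a, u, a, u, (pword R u); rewrite Cxx mul1g.
  - case: IH => [|[]-> ->|[a [u [b [v [r []]]]]]]; first by move/pwordP: ww' => ->.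
      by left.
    by right; exists b, v, a, u, r.
  - have B2 : bnd (pword R w2) n.+1 by move/pwordP: w12 => <-.
    case: (IH12 B) (IH23 B2) => [[-> E2]|[a [u [c [v [r [E1 E2 ua vc]]]]]]].
      by case=> [[_ ->]|[? [? [? [? [? []]]]]]]; [left | rewrite E2].
    rewrite E2; case=> [[]//|[_ [_ [b [w [s [[<- <-] E3 vc' wb]]]]]]].
    right; exists a, u, b, w.
    (* The tail [v] of the middle word factors both through [C c a] and through [C c b]. Having lost
       the letter [c], it is bounded by [n], so the induction hypothesis applies to the face [G1];
       the other two faces then move the common factor to the tails [u] and [w]. *)
    have [U [V [S [G1 G2 G3]]]] := cubeP a b c.
    have Bv : bnd (C c a * r) n.
      rewrite -vc; apply: (@bnd_genS c).
      by move: B2; rewrite E2 pword_cons.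
    have [z [Er Es]] := grid_lcm_upto IHn G1 (etrans (esym vc) vc') Bv.
    exists (S * z); split=> //.
      by rewrite ua Er !mulgA (grid_mul G2).
    by rewrite wb Es !mulgA (grid_mul G3).
  - right; have [a [b [u [w [-> -> Eu Ew]]]]] := CR lr.
    by exists a, (u ++ v), b, (w ++ v), (pword R v); rewrite !pwordM Eu Ew.
  - right; exists a, (u ++ l ++ v), a, (u ++ r ++ v), (pword R (u ++ l ++ v)).
    split=> //; rewrite Cxx mul1g //; apply/pwordP/cong_sym/cong_rel; exact: lr.
rewrite -[p]pword_repr -[q]pword_repr -!(pwordM R [:: _]) in E B *.
case: (key _ _ ((pwordP _ _ _).1 E) B) => [[]//|].
by move=> [? [? [? [? [r [[<- <-] [<- <-] -> ->]]]]]]; exists r.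
Qed.

Lemma grid_lcm n x y x' y' : grid x y x' y' ->
  forall p q, x * p = y * q -> bnd (x * p) n ->
  exists r, p = y' * r /\ q = x' * r.
Proof. by apply: grid_lcm_upto => ?; exact: gen_lcm. Qed.

(** Tiling terminates because a common multiple bounds it: peeling the first generators off [x] and
    [y] lowers the bound of everything that remains. *)
Lemma grid_exists n x y p q : x * p = y * q -> bnd (x * p) n ->
  exists x' y' r, [/\ grid x y x' y', p = y' * r & q = x' * r].
Proof.
elim: n x y p q => [|n IHn] x y p q.
  elim/pword_ind: x => [|a x _]; last by rewrite -mulgA => _ /bnd_gen0.
  by rewrite mul1g => -> _; exists 1, y, q; rewrite mul1g; split=> //; exact: grid_1l.
elim/pword_ind: x => [|a x _].
  by rewrite mul1g => -> _; exists 1, y, q; rewrite mul1g; split=> //; exact: grid_1l.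
elim/pword_ind: y => [|b y _].
  by rewrite [1 * q]mul1g => <- _; exists (g a * x), 1, p;
    rewrite mul1g; split=> //; exact: grid_1r.
rewrite -!mulgA => E B; have [r [Ep Eq]] := gen_lcm E B.
have Ba := bnd_genS B; rewrite E in B; have Bb := bnd_genS B.
have [x1 [y1 [s [G1 -> Er]]]] := IHn _ _ _ _ Ep Ba.
have [x2 [y2 [s' [G2 -> Er']]]] := IHn _ _ _ _ Eq Bb.
(* After the generator square and the rectangles on its two sides, only the opposite corner is left;
   [r], a right factor of [x * p], bounds it. *)
have [|x3 [y3 [z [G3 -> ->]]]] := IHn _ _ _ _ (etrans (esym Er) Er').
  by rewrite -Er; apply: (@bndM (C a b)); rewrite -Ep.
exists (y2 * x3), (y1 * y3), z; split; rewrite ?mulgA //.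
apply: grid_Mr (_ : grid _ _ (C b a * x1) y1) _.
  exact: grid_Ml (grid_gen a b) G1.
apply: grid_Ml (grid_sym G2) _; exact: G3.
Qed.

End Complement.

(** The image of a generator square need only be a grid, possibly degenerate or made of several
    tiles. This serves both the shifts inside LD+ and the projection to braids. *)
Lemma grid_morph (A B : choiceType) (R : seq A -> seq A -> Prop)
    (S : seq B -> seq B -> Prop) (C : A -> A -> presented R)
    (D : B -> B -> presented S) (f : presented R -> presented S) :
  monoid_morphism f ->
  (forall a b, grid D (f (pgen R a)) (f (pgen R b)) (f (C b a)) (f (C a b))) ->
  forall x y x' y', grid C x y x' y' -> grid D (f x) (f y) (f x') (f y').
Proof.
move=> [f1 fM] fgen x y x' y'.
elim=> {x y x' y'} [y|x|a b|x1 x2 y x1' x2' y1 y2 _ G1 _ G2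
  |x y1 y2 x1 x2 y1' y2' _ G1 _ G2]; rewrite ?f1 ?fM.
- exact: grid_1l.
- exact: grid_1r.
- exact: fgen.
- exact: grid_Ml G1 G2.
- exact: grid_Mr G1 G2.
Qed.

(** * The cube condition in LD+ *)

(* [D_a * LDcompl a b = D_b * LDcompl b a] is the only defining relation of
   the form [D_a ... = D_b ...]. *)
Fixpoint LDcompl (a b : address) : seq address :=
  match a, b with
  | [::], [::] => [::]
  | [::], false :: b' => [:: [:: false, false & b']; [:: true, false & b']]
  | [::], true :: b' =>
      match b' with
      | [::] => [:: [:: true]; [::]]
      | false :: b'' => [:: [:: false, true & b'']]
      | true :: b'' => [:: [:: true, true & b'']]
      end
  | x :: a', [::] =>
      if x && nilp a' then [:: [::]; [:: true]; [:: false]] else [:: [::]]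
  | false :: a', false :: b' => map (cons false) (LDcompl a' b')
  | true :: a', true :: b' => map (cons true) (LDcompl a' b')
  | _ :: _, _ :: _ => [:: b]
  end.

Definition LDC (a b : address) : LDmon := pword LD_rel (LDcompl a b).

Notation LDgrid := (grid LDC).
Notation LDcube := (cube LDC).

Lemma LDcompl_xx a : LDcompl a a = [::].
Proof. by elim: a => [//|[] a /= ->]. Qed.

Lemma LDcompl_cat c a b :
  LDcompl (c ++ a) (c ++ b) = map (cat c) (LDcompl a b).
Proof. by elim: c => [|[] c IH]; rewrite /= ?IH -?map_comp //= map_id. Qed.

Lemma LDC_xx a : LDC a a = 1.
Proof. by rewrite /LDC LDcompl_xx. Qed.

Lemma LDC_cat c a b : LDC (c ++ a) (c ++ b) = sh c (LDC a b).
Proof. by rewrite /LDC LDcompl_cat sh_word. Qed.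

Lemma LDC_rel l r : LD_rel l r -> exists a b u v,
  [/\ l = a :: u, r = b :: v, pword LD_rel u = LDC a b & pword LD_rel v = LDC b a].
Proof.
have cat0 c d : LDcompl (c ++ d) c = map (cat c) (LDcompl d [::]).
  by rewrite -LDcompl_cat cats0.
have cat0' c d : LDcompl c (c ++ d) = map (cat c) (LDcompl [::] d).
  by rewrite -LDcompl_cat cats0.
case=> [a b c|a b|a b|a b|a].
- exists (a ++ false :: b), (a ++ true :: c), [:: a ++ true :: c],
    [:: a ++ false :: b].
  by rewrite /LDC !LDcompl_cat.
- exists (a ++ false :: b), a, [:: a],
    [:: a ++ false :: false :: b; a ++ true :: false :: b].
  by rewrite /LDC cat0 cat0' /= cats0.
- exists (a ++ true :: false :: b), a, [:: a], [:: a ++ false :: true :: b].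
  by rewrite /LDC cat0 cat0' /= cats0.
- exists (a ++ true :: true :: b), a, [:: a], [:: a ++ true :: true :: b].
  by rewrite /LDC cat0 cat0' /= cats0.
- exists a, (a ++ [:: true]), [:: a ++ [:: true]; a],
    [:: a; a ++ [:: true]; a ++ [:: false]].
  by rewrite /LDC cat0 cat0' /= cats0.
Qed.

Lemma LDC_square a b : Dgen a * LDC a b = Dgen b * LDC b a.
Proof.
elim: a b => [|x a IH] [|y b].
- by rewrite LDC_xx.
- case: y b => [[|[] b]|b]; rewrite -!pwordM.
  + exact: pword_rel (LD_rel_1 [::]).
  + symmetry; exact: pword_rel (LD_rel_11 [::] b).
  + symmetry; exact: pword_rel (LD_rel_10 [::] b).
  + symmetry; exact: pword_rel (LD_rel_0 [::] b).
- case: x a {IH} => [[|[] a]|a]; rewrite -!pwordM.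
  + symmetry; exact: pword_rel (LD_rel_1 [::]).
  + exact: pword_rel (LD_rel_11 [::] a).
  + exact: pword_rel (LD_rel_10 [::] a).
  + exact: pword_rel (LD_rel_0 [::] a).
- case: x y => [] [].
  + by rewrite !(LDC_cat [:: true]) -!(sh_D [:: true]) -!gmulfM IH.
  + rewrite -!pwordM; symmetry.
    exact: pword_rel (LD_rel_perp [::] b a).
  + rewrite -!pwordM.
    exact: pword_rel (LD_rel_perp [::] a b).
  + by rewrite !(LDC_cat [:: false]) -!(sh_D [:: false]) -!gmulfM IH.
Qed.

Lemma LDgrid_D a b : LDgrid (Dgen a) (Dgen b) (LDC b a) (LDC a b).
Proof. exact: grid_gen. Qed.

Lemma LDgrid_sh c x y x' y' :
  LDgrid x y x' y' -> LDgrid (sh c x) (sh c y) (sh c x') (sh c y').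
Proof.
apply: grid_morph => [|a b]; first exact: plift_is_morphism (sh_respects c).
by rewrite -!LDC_cat !sh_D; exact: LDgrid_D.
Qed.

Lemma LDcube_cat d a b c : LDcube a b c -> LDcube (d ++ a) (d ++ b) (d ++ c).
Proof.
move=> [u [v [w [G1 G2 G3]]]]; exists (sh d u), (sh d v), (sh d w).
by rewrite !LDC_cat; split; exact: LDgrid_sh.
Qed.

Lemma LDmon_ind (P : LDmon -> Prop) :
  P 1 -> (forall a x, P x -> P (Dgen a * x)) -> forall x, P x.
Proof. exact: pword_ind. Qed.

(** * Grids between shifted elements *)

Section ShiftedGenerators.
Variables (f h : LDmon -> LDmon) (fM : monoid_morphism f) (hM : monoid_morphism h).
Variable y : LDmon.
Hypothesis fhD : forall a, LDgrid (f (Dgen a)) y (h (Dgen a)) y.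

Lemma LDgrid_stable x : LDgrid (f x) y (h x) y.
Proof.
elim/LDmon_ind: x => [|a x IH]; first by rewrite fM.1 hM.1; exact: grid_1l.
by rewrite fM.2 hM.2; apply: grid_Ml IH.
Qed.

End ShiftedGenerators.

Lemma sh_morph c : monoid_morphism (sh c).
Proof. exact: plift_is_morphism (sh_respects c). Qed.

Lemma LDgrid_perp_D c a b :
  LDgrid (Dgen (c ++ false :: a)) (Dgen (c ++ true :: b))
         (Dgen (c ++ false :: a)) (Dgen (c ++ true :: b)).
Proof. by rewrite -!(sh_D c); apply: LDgrid_sh; exact: LDgrid_D. Qed.

Lemma LDgrid_perp c a b x y :
  LDgrid (sh (c ++ false :: a) x) (sh (c ++ true :: b) y)
         (sh (c ++ false :: a) x) (sh (c ++ true :: b) y).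
Proof.
apply: LDgrid_stable; try exact: sh_morph.
move=> d; apply: grid_sym; apply: LDgrid_stable; try exact: sh_morph.
by move=> e; rewrite !sh_D -!catA; apply/grid_sym/LDgrid_perp_D.
Qed.

Lemma sh_perp c a b x y :
  sh (c ++ false :: a) x * sh (c ++ true :: b) y =
  sh (c ++ true :: b) y * sh (c ++ false :: a) x.
Proof. exact: grid_mul LDC_square _ _ _ _ (LDgrid_perp c a b x y). Qed.

(** [D] at the root duplicates the left subterm, so whatever acts there is copied to the addresses
    00 and 10. *)
Lemma LDgrid_0e x :
  LDgrid (sh [:: false] x) (Dgen [::])
         (sh [:: false; false] x * sh [:: true; false] x) (Dgen [::]).
Proof.
apply: (@LDgrid_stable (sh [:: false])
  (fun x => sh [:: false; false] x * sh [:: true; false] x)) => [||a].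
- exact: sh_morph.
- split=> [|u v]; first by rewrite !gmulf1 mulg1.
  (* Doubling is multiplicative because the two copies act on disjoint subterms and commute. *)
  rewrite !gmulfM -!mulgA; congr (_ * _).
  by rewrite !mulgA (sh_perp [::] [:: false] [:: false] v u).
- rewrite !sh_D -[Dgen _ * _]pwordM; exact: LDgrid_D [:: false & a] [::].
Qed.

Lemma LDgrid_10e x :
  LDgrid (sh [:: true; false] x) (Dgen [::]) (sh [:: false; true] x) (Dgen [::]).
Proof.
apply: LDgrid_stable; try exact: sh_morph.
by move=> a; rewrite !sh_D; exact: LDgrid_D [:: true, false & a] [::].
Qed.

Lemma LDgrid_11e x :
  LDgrid (sh [:: true; true] x) (Dgen [::]) (sh [:: true; true] x) (Dgen [::]).
Proof.
apply: LDgrid_stable; try exact: sh_morph.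
by move=> a; rewrite !sh_D; exact: LDgrid_D [:: true, true & a] [::].
Qed.

Lemma LDgrid_par c a b x y x' y' z t z' t' :
  LDgrid x y x' y' -> LDgrid z t z' t' ->
  LDgrid (sh (c ++ false :: a) x * sh (c ++ true :: b) z)
         (sh (c ++ false :: a) y * sh (c ++ true :: b) t)
         (sh (c ++ false :: a) x' * sh (c ++ true :: b) z')
         (sh (c ++ false :: a) y' * sh (c ++ true :: b) t').
Proof.
move=> Gx Gz; apply: grid_Ml.
  by apply: grid_Mr; [exact: LDgrid_sh Gx | exact: LDgrid_perp].
by apply: grid_Mr; [apply: grid_sym; exact: LDgrid_perp | exact: LDgrid_sh].
Qed.

(** For addresses other than the empty one and 1, the root generator crosses unchanged; the second
    edge from the root is then [Dgen [::]] itself, and three simple faces remain. *)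
Lemma LDcube_root x y u w :
  LDC x [::] = Dgen [::] -> LDC y [::] = Dgen [::] ->
  LDgrid (Dgen [::]) (LDC y x) (Dgen [::]) u ->
  LDgrid (Dgen [::]) (LDC x y) (Dgen [::]) w ->
  LDgrid (LDC [::] x) (LDC [::] y) u w -> LDcube [::] x y.
Proof.
by move=> Ex Ey G1 G2 G3; exists u, (Dgen [::]), w; rewrite Ex Ey.
Qed.

Lemma LDcube_root_00 a b : LDcube [::] (false :: a) (false :: b).
Proof.
have L c d : LDC (false :: c) (false :: d) = sh [:: false] (LDC c d).
  exact: (LDC_cat [:: false]).
have R c : LDC [::] (false :: c) =
    sh [:: false; false] (Dgen c) * sh [:: true; false] (Dgen c).
  by rewrite !sh_D -pwordM.
apply: (@LDcube_root _ _
    (sh [:: false; false] (LDC b a) * sh [:: true; false] (LDC b a))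
    (sh [:: false; false] (LDC a b) * sh [:: true; false] (LDC a b))) => //.
- by rewrite L; apply/grid_sym/LDgrid_0e.
- by rewrite L; apply/grid_sym/LDgrid_0e.
- by rewrite !R; apply: (LDgrid_par [::] [:: false] [:: false]); exact: LDgrid_D.
Qed.

Lemma LDcube_root_1010 a b :
  LDcube [::] [:: true, false & a] [:: true, false & b].
Proof.
have L c d : LDC [:: true, false & c] [:: true, false & d] =
    sh [:: true; false] (LDC c d).
  exact: (LDC_cat [:: true; false]).
have R c : LDC [::] [:: true, false & c] = sh [:: false; true] (Dgen c).
  by rewrite sh_D.
apply: (@LDcube_root _ _ (sh [:: false; true] (LDC b a))
    (sh [:: false; true] (LDC a b))) => //.
- by rewrite L; apply/grid_sym/LDgrid_10e.
- by rewrite L; apply/grid_sym/LDgrid_10e.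
- by rewrite !R; apply: LDgrid_sh; exact: LDgrid_D.
Qed.

Lemma LDcube_root_1111 a b :
  LDcube [::] [:: true, true & a] [:: true, true & b].
Proof.
have L c d : LDC [:: true, true & c] [:: true, true & d] =
    sh [:: true; true] (LDC c d).
  exact: (LDC_cat [:: true; true]).
apply: (@LDcube_root _ _ (sh [:: true; true] (LDC b a))
    (sh [:: true; true] (LDC a b))) => //.
- by rewrite L; apply/grid_sym/LDgrid_11e.
- by rewrite L; apply/grid_sym/LDgrid_11e.
- by rewrite -!L; exact: (LDgrid_D [:: true, true & a] [:: true, true & b]).
Qed.

Lemma LDcube_root_perp x y :
  LDC x [::] = Dgen [::] -> LDC y [::] = Dgen [::] ->
  LDC x y = Dgen y -> LDC y x = Dgen x ->
  LDgrid (LDC [::] x) (LDC [::] y) (LDC [::] x) (LDC [::] y) ->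
  LDcube [::] x y.
Proof.
move=> Ex Ey Exy Eyx; apply: LDcube_root => //.
- by rewrite Eyx -{2}Ex; exact: LDgrid_D.
- by rewrite Exy -{2}Ey; exact: LDgrid_D.
Qed.

Lemma LDC_root_0 a : LDC [::] (false :: a) =
  Dgen [:: false, false & a] * Dgen [:: true, false & a].
Proof. by rewrite -pwordM. Qed.

Lemma LDcube_root_0_10 a b : LDcube [::] (false :: a) [:: true, false & b].
Proof.
apply: LDcube_root_perp => //.
rewrite LDC_root_0.
apply: grid_Ml.
- exact: (LDgrid_perp_D [:: false] a b).
- exact/grid_sym/(LDgrid_perp_D [::] (true :: b) (false :: a)).
Qed.

Lemma LDcube_root_0_11 a b : LDcube [::] (false :: a) [:: true, true & b].
Proof.
apply: LDcube_root_perp => //.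
rewrite LDC_root_0.
apply: grid_Ml.
- exact: (LDgrid_perp_D [::] (false :: a) (true :: b)).
- exact: (LDgrid_perp_D [:: true] a b).
Qed.

Lemma LDcube_root_10_11 a b :
  LDcube [::] [:: true, false & a] [:: true, true & b].
Proof.
apply: LDcube_root_perp => //.
exact: (LDgrid_perp_D [::] (true :: a) (true :: b)).
Qed.

(* Word reversing, with fuel: [wrev n u v = Some (u', v')] certifies the
   equality [u v' = v u'], obtained by filling a grid with generator squares. *)
Fixpoint wrev n (u v : seq address) : option (seq address * seq address) :=
  if n is n'.+1 then
    match u, v with
    | [::], _ => Some ([::], v)
    | _, [::] => Some (u, [::])
    | [:: a], b :: v' =>
        obind (fun r => Some (r.1, LDcompl a b ++ r.2)) (wrev n' (LDcompl b a) v')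
    | a :: u', _ =>
        obind (fun r => obind (fun s => Some (r.1 ++ s.1, s.2)) (wrev n' u' r.2))
          (wrev n' [:: a] v)
    end
  else None.

Lemma wrev_grid n u v u' v' : wrev n u v = Some (u', v') ->
  LDgrid (pword LD_rel u) (pword LD_rel v) (pword LD_rel u') (pword LD_rel v').
Proof.
elim: n u v u' v' => [//|n IH] [|a u] v u' v'.
  by move=> [<- <-]; exact: grid_1l.
case: v => [|b v]; first by case: u => [|c u] [<- <-]; exact: grid_1r.
case: u => [|c u].
  rewrite /=; case E: (wrev n _ v) => [[u1 v1]|] //= [<- <-].
  rewrite -[b :: v]/([:: b] ++ v) !pwordM.
  exact: grid_Mr (LDgrid_D a b) (IH _ _ _ _ E).
rewrite -[wrev _ _ _]/(obind (fun r => obind (fun s => Some (r.1 ++ s.1, s.2))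
  (wrev n (c :: u) r.2)) (wrev n [:: a] (b :: v))).
case E: (wrev n [:: a] _) => [[u1 v1]|] //=.
case E' : (wrev n (c :: u) _) => [[u2 v2]|] //= [<- <-].
rewrite -[a :: c :: u]/([:: a] ++ _) !pwordM.
exact: grid_Ml (IH _ _ _ _ E) (IH _ _ _ _ E').
Qed.

Lemma wrev_eq n u v : wrev n u v = Some ([::], [::]) ->
  pword LD_rel u = pword LD_rel v.
Proof.
by move=> /wrev_grid /(grid_mul LDC_square); rewrite !mulg1.
Qed.

(** Two faces meeting along an edge may be computed with different words for that edge; hence the
    three equalities in the monoid. *)
Lemma wrev_cube n a b c u v w u' v' w' :
  wrev n (LDcompl c a) (LDcompl c b) = Some (v, u) ->
  wrev n (LDcompl a b) (LDcompl a c) = Some (u', w) ->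
  wrev n (LDcompl b a) (LDcompl b c) = Some (v', w') ->
  pword LD_rel u' = pword LD_rel u -> pword LD_rel v' = pword LD_rel v ->
  pword LD_rel w' = pword LD_rel w -> LDcube a b c.
Proof.
move=> /wrev_grid G1 /wrev_grid G2 /wrev_grid G3 Eu Ev Ew.
rewrite Eu in G2; rewrite Ev Ew in G3.
by exists (pword LD_rel u), (pword LD_rel v), (pword LD_rel w).
Qed.

Lemma LDcube_root_11_1 : LDcube [::] [:: true; true] [:: true].
Proof.
(* The value 30 is only fuel; running out would give [None]. Edges reached by different words are
   compared by reversing one against the other down to empty words. *)
by apply: (@wrev_cube 30); try reflexivity; apply: (@wrev_eq 30); vm_compute.
Qed.

Lemma LDcube_root_0_1 b : LDcube [::] (false :: b) [:: true].
Proof.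
apply: (@wrev_cube 30); try reflexivity.
(* The generator of the left subterm has been copied four times; the two words for this edge differ
   by the order of the two middle copies, which commute. *)
apply/pwordP/cong_sym.
cbn; exact: (cong_rel [:: [:: false, false, false & b]]
  [:: [:: true, true, false & b]]
  (LD_rel_perp [::] [:: true, false & b] [:: false, false & b])).
Qed.

Lemma LDcube_root_10_1 b : LDcube [::] [:: true, false & b] [:: true].
Proof. by apply: (@wrev_cube 30). Qed.

Lemma LDcube_root_110_1 b : LDcube [::] [:: true, true, false & b] [:: true].
Proof. by apply: (@wrev_cube 30). Qed.

Lemma LDcube_root_111_1 b : LDcube [::] [:: true, true, true & b] [:: true].
Proof. by apply: (@wrev_cube 30). Qed.

Lemma LDcube_root_sym x y : LDcube [::] x y -> LDcube [::] y x.
Proof. by move=> /cube_swap13 /cube_swap12 /cube_swap13. Qed.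

Lemma LDcube_root1 x : LDcube [::] x [:: true].
Proof.
case: x => [|[] [|[] x]]; first exact: cube_xx LDC_xx _ _.
- apply: cube_swap13; apply: cube_xx; exact: LDC_xx.
- case: x => [|[] x]; [exact: LDcube_root_11_1 | exact: LDcube_root_111_1|].
  exact: LDcube_root_110_1.
- exact: LDcube_root_10_1.
- exact: LDcube_root_0_1.
- exact: LDcube_root_0_1.
- exact: LDcube_root_0_1.
Qed.

(** Seen from the root, addresses fall into five classes: empty, 1, 0b, 10b, 11b. The address 1,
    whose relation with the root is of braid type, is removed first. *)
Lemma LDcube_root_all x y : LDcube [::] x y.
Proof.
have [->|nx] := eqVneq x [:: true]; first exact/LDcube_root_sym/LDcube_root1.
have [->|ny] := eqVneq y [:: true]; first exact/LDcube_root1.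
case: x nx => [|[] [//|[] x]] _; first exact: cube_xx LDC_xx _ _.
all: case: y ny => [|[] [//|[] y]] _.
all: try exact/cube_swap12/cube_swap13/cube_xx/LDC_xx.
all: first [exact: LDcube_root_1111 | exact: LDcube_root_1010
 | exact: LDcube_root_00 | exact: LDcube_root_10_11 | exact: LDcube_root_0_10
 | exact: LDcube_root_0_11 | exact/LDcube_root_sym/LDcube_root_10_11
 | exact/LDcube_root_sym/LDcube_root_0_10
 | exact/LDcube_root_sym/LDcube_root_0_11].
Qed.

(** * Cubes of nonempty addresses *)

Lemma LDcube_side x y z :
  LDC z x = Dgen x -> LDC z y = Dgen y -> LDC x z = Dgen z -> LDC y z = Dgen z ->
  LDgrid (LDC x y) (Dgen z) (LDC x y) (Dgen z) ->
  LDgrid (LDC y x) (Dgen z) (LDC y x) (Dgen z) ->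
  LDcube x y z.
Proof.
move=> zx zy xz yz G1 G2; exists (LDC x y), (LDC y x), (Dgen z).
by rewrite zx zy xz yz; split=> //; exact: LDgrid_D.
Qed.

Lemma LDcube_00_1 a b c : LDcube (false :: a) (false :: b) (true :: c).
Proof.
apply: LDcube_side => //; rewrite (LDC_cat [:: false]) -(sh_D [:: true]);
  exact: (LDgrid_perp [::] [::] [::]).
Qed.

Lemma LDcube_11_0 a b c : LDcube (true :: a) (true :: b) (false :: c).
Proof.
apply: LDcube_side => //; rewrite (LDC_cat [:: true]) -(sh_D [:: false]);
  exact/grid_sym/(LDgrid_perp [::] [::] [::]).
Qed.

Lemma LDcubeP a b c : LDcube a b c.
Proof.
elim: a b c => [|x a IH] b c; first exact: LDcube_root_all.
case: b => [|y b]; first exact/cube_swap12/LDcube_root_all.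
case: c => [|z c]; first exact/cube_swap13/LDcube_root_all.
case: x y z => [] [] [];
  first [ exact: (LDcube_cat [:: true] (IH b c))
        | exact: (LDcube_cat [:: false] (IH b c))
        | exact: LDcube_00_1 | exact: LDcube_11_0
        | exact/cube_swap13/LDcube_00_1 | exact/cube_swap13/LDcube_11_0
        | exact/cube_swap12/cube_swap13/LDcube_00_1
        | exact/cube_swap12/cube_swap13/LDcube_11_0 ].
Qed.

(** * The category LD+ is left-preGarside *)

Fixpoint leaves (t : term) : nat :=
  if t is Star t0 t1 then leaves t0 + leaves t1 else 1.

Lemma leaves_gt0 t : 0 < leaves t.
Proof. by elim: t => //= t0 IH t1 _; rewrite addn_gt0 IH. Qed.

Lemma actD_leaves t a t' : actD t a = Some t' -> leaves t < leaves t'.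
Proof.
elim: t a t' => [i|t0 IH0 t1 IH1] a t'; first by rewrite actD_Var.
case: a => [|[] a]; rewrite ?actD_Star0 ?actD_Star1.
- case: t1 {IH1} => [//|t1 t2] [<-] /=.
  by rewrite addnACA ltn_add2r -[ltnLHS]addn0 ltn_add2l leaves_gt0.
- by case E: (actD t1 a) => [s|] //= [<-] /=; rewrite ltn_add2l (IH1 _ _ E).
- by case E: (actD t0 a) => [s|] //= [<-] /=; rewrite ltn_add2r (IH0 _ _ E).
Qed.

Lemma act_mulP t x y t' : act t (x * y) = Some t' <->
  exists2 s, act t x = Some s & act s y = Some t'.
Proof.
rewrite actM; case: (act t x) => [s|] /=; last by split=> [|[]].
by split=> [|[_ [<-]]] //; exists s.
Qed.

Lemma act_leaves t x t' : act t x = Some t' -> leaves t <= leaves t'.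
Proof.
elim/LDmon_ind: x t => [|a x IH] t; first by rewrite act1 => -[->].
move=> /act_mulP[s]; rewrite act_D => /actD_leaves ts /IH; apply: leq_trans.
exact: ltnW.
Qed.

(** Word length is not invariant under the relations of LD+. Each generator adds at least one leaf
    to the term it acts on, so the growth of some term bounds all words for [x]. *)
Definition LDbnd (x : LDmon) (n : nat) : Prop :=
  exists t t', act t x = Some t' /\ leaves t' <= leaves t + n.

Lemma LDbndM x y n : LDbnd (x * y) n -> LDbnd y n.
Proof.
move=> [t [t' [/act_mulP[s /act_leaves ts sy] le]]]; exists s, t'; split=> //.
by apply: leq_trans le _; rewrite leq_add2r.
Qed.

Lemma LDbnd_gen0 a y : ~ LDbnd (Dgen a * y) 0.
Proof.
move=> [t [t' [/act_mulP[s]]]]; rewrite act_D => /actD_leaves ts /act_leaves st.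
by rewrite addn0 leqNgt (leq_trans ts st).
Qed.

Lemma LDbnd_genS a y n : LDbnd (Dgen a * y) n.+1 -> LDbnd y n.
Proof.
move=> [t [t' [/act_mulP[s]]]]; rewrite act_D => /actD_leaves ts sy le.
exists s, t'; split=> //; apply: leq_trans le _.
by rewrite addnS -addSn leq_add2r.
Qed.

Lemma act_bnd t x t' : act t x = Some t' -> LDbnd x (leaves t').
Proof. by move=> tx; exists t, t'; split=> //; exact: leq_addl. Qed.

Lemma LDgrid_lcm x y x' y' p q t t' : LDgrid x y x' y' ->
  x * p = y * q -> act t (x * p) = Some t' ->
  exists r, p = y' * r /\ q = x' * r.
Proof.
move=> G E /act_bnd B.
exact: (grid_lcm LDC_rel LDC_xx LDC_square LDbndM LDbnd_gen0 LDbnd_genS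
  LDcubeP G E B).
Qed.

Lemma LDgrid_exists x y p q t t' :
  x * p = y * q -> act t (x * p) = Some t' ->
  exists x' y' r, [/\ LDgrid x y x' y', p = y' * r & q = x' * r].
Proof.
move=> E /act_bnd B.
exact: (grid_exists LDC_rel LDC_xx LDC_square LDbndM LDbnd_gen0 LDbnd_genS
  LDcubeP E B).
Qed.

Lemma LD_left_cancel x p q t t' :
  x * p = x * q -> act t (x * p) = Some t' -> p = q.
Proof.
by move=> E tx; have [r [-> ->]] := LDgrid_lcm (grid_xx LDC_xx x) E tx.
Qed.

Definition LDmor t t' x (tx : act t x = Some t') : @Hom LDcat t t' :=
  exist _ x (introT eqP tx).

Lemma LD_ldivP (t s s' : LDcat) (f : Hom t s) (g : Hom t s') :
  ldiv f g <-> exists u, LDmid f * u = LDmid g.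
Proof.
split=> [[h <-]|[u fu]]; first by exists (LDmid h).
have us : act s u == Some s'.
  move: (valP g); rewrite -[val g]/(LDmid g) -fu => /eqP /act_mulP[s1].
  by rewrite (eqP (valP f)) => -[<-] ->.
by exists (exist _ u us); apply: val_inj.
Qed.

Lemma LD_nontrivial (t s : LDcat) (f : Hom t s) : nontrivial f ->
  exists a x, LDmid f = Dgen a * x.
Proof.
case: f => x tx; elim/LDmon_ind: x tx => [|a x _] tx ntf; last by exists a, x.
case: ntf; have ts : t = s by move: (eqP tx); rewrite act1 => -[].
case: s / ts tx => tx.
rewrite (_ : exist _ _ _ = idm (c := LDcat) t); first exact: IsIdentity.
exact: val_inj.
Qed.

Lemma LD_nontrivial_leaves (t s : LDcat) (f : Hom t s) :
  nontrivial f -> leaves t < leaves s.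
Proof.
move=> /LD_nontrivial[a [x fx]]; have /eqP := valP f.
rewrite -[val f]/(LDmid f) fx => /act_mulP[u]; rewrite act_D => /actD_leaves tu.
by move=> /act_leaves; exact: leq_trans.
Qed.

Lemma LD_LG0 : LG0 LDcat.
Proof.
move=> t s f [z [g [gf gg]]].
have lt n : n < leaves (z n).
  elim: n => [|n IH]; first exact: leaves_gt0.
  have [h [/LD_nontrivial_leaves zz _]] := gg n; exact: leq_ltn_trans zz.
have [h _] := gf (leaves s); have := act_leaves (eqP (valP h)).
by rewrite leqNgt lt.
Qed.

Lemma LD_LG1 : LG1 LDcat.
Proof.
move=> t s u f g g' /(congr1 val) E; apply: val_inj.
exact: LD_left_cancel E (eqP (valP (mcomp f g))).
Qed.

Lemma LDgrid_right_lcm (t s s' w : LDcat) (f : Hom t s) (g : Hom t s')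
    (h : Hom t w) x' y' :
  LDgrid (LDmid f) (LDmid g) x' y' -> LDmid h = LDmid f * y' -> right_lcm f g h.
Proof.
move=> G E; have E' : LDmid h = LDmid g * x'.
  by rewrite E; exact: grid_mul LDC_square _ _ _ _ G.
split; first by split; apply/LD_ldivP; [exists y' | exists x'].
move=> w' h' [/LD_ldivP[p fp] /LD_ldivP[q gq]]; apply/LD_ldivP.
have [||r [Er _]] := @LDgrid_lcm _ _ _ _ p q t w' G; first by rewrite fp gq.
  by rewrite fp; exact/eqP/(valP h').
by exists r; rewrite -fp E Er mulgA.
Qed.

Lemma LD_common_multiple_grid (t s s' w : LDcat) (f : Hom t s) (g : Hom t s')
    (h : Hom t w) : common_right_multiple f g h ->
  exists x' y' (w' : LDcat) (h' : Hom t w'),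
    LDgrid (LDmid f) (LDmid g) x' y' /\ LDmid h' = LDmid f * y'.
Proof.
move=> [/LD_ldivP[p fp] /LD_ldivP[q gq]].
have th : act t (LDmid f * p) = Some w by rewrite fp; exact/eqP/(valP h).
(* The lcm read off the grid left-divides [h], which is why its action on [t] is defined. *)
have [x' [y' [r [G E _]]]] := LDgrid_exists (etrans fp (esym gq)) th.
move: th; rewrite E mulgA => /act_mulP[w' tw' _].
by exists x', y', w', (LDmor tw').
Qed.

Lemma LD_LG2 : LG2 LDcat.
Proof.
move=> t s s' f g [w [h /LD_common_multiple_grid[x' [y' [w' [h' [G E]]]]]]].
by exists w', h'; exact: LDgrid_right_lcm G E.
Qed.

(** * The left-Garside map *)

Lemma sh_cat c d x : sh c (sh d x) = sh (c ++ d) x.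
Proof.
rewrite -[x]pword_repr !sh_word -map_comp; congr pword.
by apply: eq_map => w /=; rewrite catA.
Qed.

Lemma shM c x y : sh c (x * y) = sh c x * sh c y.
Proof. exact: (sh_morph c).2. Qed.

Lemma sh1 c : sh c 1 = 1.
Proof. exact: (sh_morph c).1. Qed.

Lemma sh0_root x : sh [:: false] x * Dgen [::] =
  Dgen [::] * sh [:: false; false] x * sh [:: true; false] x.
Proof. by rewrite -mulgA; exact: grid_mul LDC_square _ _ _ _ (LDgrid_0e x). Qed.

Lemma sh10_root x :
  sh [:: true; false] x * Dgen [::] = Dgen [::] * sh [:: false; true] x.
Proof. exact: grid_mul LDC_square _ _ _ _ (LDgrid_10e x). Qed.

Lemma sh11_root x :
  sh [:: true; true] x * Dgen [::] = Dgen [::] * sh [:: true; true] x.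
Proof. exact: grid_mul LDC_square _ _ _ _ (LDgrid_11e x). Qed.

Lemma Dgen_root1 : Dgen [::] * Dgen [:: true] * Dgen [::] =
  Dgen [:: true] * Dgen [::] * Dgen [:: true] * Dgen [:: false].
Proof.
have:= pword_rel (LD_rel_1 [::]).
by rewrite !pword_cons -[pword _ [::]]/(1 : LDmon) !mulg1 -!mulgA.
Qed.

Lemma sh01C x y :
  sh [:: true] y * sh [:: false] x = sh [:: false] x * sh [:: true] y.
Proof. by rewrite (sh_perp [::] [::] [::]). Qed.

(** [delta t] turns [Star s t] into [circ s t], which has the shape of [t] with [s] grafted at each
    leaf. A rewriting at [a] inside [t], located at 1a before distribution, is thus located at [a]
    afterwards. *)
Lemma delta_actD t a t' : actD t a = Some t' ->
  Dgen (true :: a) * delta t' = delta t * Dgen a.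
Proof.
elim: t a t' => [i|t1 IH1 t IHt] a t'; first by rewrite actD_Var.
case: a => [|[] a]; rewrite ?actD_Star0 ?actD_Star1.
- case: t {IHt} => [//|t2 t3] [<-] /=.
  (* At the empty address, moving the last root generator leftwards makes [D_eps D_1 D_eps] appear,
     to which the braid-type relation applies. *)
  rewrite !shM !sh_D !sh_cat /= !mulgA.
  have -> : Dgen [::] * sh [:: false] (delta t1) * Dgen [:: true]
      * sh [:: true; false] (delta t2) * sh [:: true; true] (delta t3) * Dgen [::]
    = Dgen [::] * Dgen [:: true] * Dgen [::] * sh [:: false; false] (delta t1)
      * sh [:: true; false] (delta t1) * sh [:: false; true] (delta t2)
      * sh [:: true; true] (delta t3).
    rewrite -!mulgA sh11_root [in LHS](mulgA (sh [:: true; false] _)) sh10_root.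
    rewrite [in LHS](mulgA (sh [:: false] _)) -(sh_D [:: true] [::]) -sh01C.
    rewrite -!mulgA [in LHS](mulgA (sh [:: false] _)).
    by rewrite sh0_root -!mulgA.
  rewrite Dgen_root1 -!mulgA; do 2 congr (_ * _).
  rewrite -(sh_D [:: true] [::]) -(sh_D [:: false] [::]).
  rewrite -(sh_cat [:: false] [:: false]) -(sh_cat [:: false] [:: true]).
  rewrite -(sh_cat [:: true] [:: false]).
  rewrite (mulgA (sh [:: true] _) (sh [:: false] (sh [:: true] _))) sh01C.
  rewrite -!mulgA (mulgA (sh [:: true] _) (sh [:: false] _)) sh01C -!mulgA.
  congr (_ * _).
  rewrite (mulgA (sh [:: true] _) (sh [:: false] _)) sh01C -!mulgA.
  congr (_ * _).
  by rewrite (mulgA (sh [:: true] _) (sh [:: false] _)) sh01C -!mulgA.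
- case E: (actD t a) => [s|] //= [<-] /=.
  rewrite !mulgA -(sh_D [:: true; true] a) sh11_root -!mulgA.
  rewrite -(sh_cat [:: true] [:: true]) (mulgA (sh [:: true] _)) sh01C -!mulgA.
  by rewrite -shM sh_D (IHt _ _ E) shM sh_D.
- case E: (actD t1 a) => [s|] //= [<-] /=.
  rewrite !mulgA -(sh_D [:: true; false] a) sh10_root -!mulgA.
  congr (_ * _); rewrite -(sh_cat [:: false] [:: true]) mulgA -shM sh_D.
  by rewrite (IH1 _ _ E) shM -mulgA -sh01C sh_D.
Qed.

Lemma delta_act t x t' : act t x = Some t' ->
  sh [:: true] x * delta t' = delta t * x.
Proof.
elim/LDmon_ind: x t => [|a x IH] t.
  by rewrite act1 => -[->]; rewrite sh1 mul1g mulg1.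
move=> /act_mulP[s]; rewrite act_D => /delta_actD ts /IH xs.
by rewrite shM -mulgA xs sh_D !mulgA -ts.
Qed.

(** Distribution copies the left factor to every leaf of [t], so [y] is the product of the
    corresponding copies of [x]. *)
Lemma delta_sh0 t x : exists y, sh [:: false] x * delta t = delta t * y.
Proof.
elim: t x => [i|t0 IH0 t1 IH1] x /=.
  by exists (sh [:: false] x); rewrite mul1g mulg1.
have [y0 E0] := IH0 x; have [y1 E1] := IH1 x.
exists (sh [:: false] y0 * sh [:: true] y1).
rewrite !mulgA sh0_root -!mulgA; congr (_ * _).
rewrite -(sh_cat [:: false] [:: false]) -(sh_cat [:: true] [:: false]).
rewrite (mulgA (sh [:: true] _)) sh01C -!mulgA -shM E1.
rewrite mulgA -shM E0 !shM -!mulgA; congr (_ * _).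
by rewrite [RHS]mulgA sh01C -mulgA.
Qed.

(** The top part of [circ s t] is [t] itself, each leaf being enlarged; distributing over [circ s t]
    can therefore start by distributing over [t]. *)
Lemma delta_circ s t : exists y, delta (circ s t) = delta t * y.
Proof.
elim: t => [i|t0 [y0 E0] t1 [y1 E1]] /=.
  by eexists; rewrite mul1g.
exists (sh [:: false] y0 * sh [:: true] y1).
rewrite E0 E1 !shM -!mulgA; do 2 congr (_ * _).
by rewrite [RHS]mulgA sh01C -mulgA.
Qed.

Lemma delta_circ_r s t : sh [:: true] (delta t) * delta (circ s t)
  = delta (Star s t) * delta t.
Proof. by apply: delta_act; exact: act_delta. Qed.

(** This form shows the root generator as a left divisor. Its middle factors are those of [Delta] at
    the term obtained by applying that generator, so only the final [delta] factors remain to be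
    compared. *)
Lemma Delta_Star_Star t1 t2 t3 : Delta (Star t1 (Star t2 t3)) =
  Dgen [::] * sh [:: false] (Delta (Star t1 t2))
            * sh [:: true] (Delta (Star t1 t3)) * delta (phi t3).
Proof.
(* [delta_circ_r] creates a factor [delta (Star (phi t2) (phi t3))], which begins with the root
   generator; that generator is then carried to the front. *)
rewrite /= !shM !sh_cat /= -!mulgA delta_circ_r /= -!mulgA.
rewrite (mulgA (sh [:: true; true] _) (Dgen _)) sh11_root -!mulgA.
rewrite (mulgA (sh [:: true; false] _) (Dgen _)) sh10_root -!mulgA.
rewrite (mulgA (sh [:: false] _) (Dgen _)) sh0_root -!mulgA.
do 2 congr (_ * _).
rewrite -!(sh_cat [:: true] [:: true]) -!(sh_cat [:: true] [:: false]).
rewrite -!(sh_cat [:: false] [:: true]).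
rewrite [LHS]mulgA sh01C -!mulgA; congr (_ * _).
rewrite [X in _ * X]mulgA sh01C -!mulgA [LHS]mulgA sh01C -!mulgA.
by [].
Qed.

Lemma Delta_actD t a t' : actD t a = Some t' ->
  (exists x, Delta t = Dgen a * x) /\
  (exists x, Dgen a * Delta t' = Delta t * x).
Proof.
elim: t a t' => [i|t0 IH0 t1 IH1] a t'; first by rewrite actD_Var.
case: a => [|[] a]; rewrite ?actD_Star0 ?actD_Star1.
- case: t1 {IH1} => [//|t1 t2] [<-].
  rewrite Delta_Star_Star; split; first by eexists; rewrite -!mulgA.
  rewrite -[Delta (Star (Star _ _) _)]/(_ * _ * delta (circ (phi t0) (phi t2))).
  by have [y ->] := delta_circ (phi t0) (phi t2); exists y; rewrite !mulgA.
- case E: (actD t1 a) => [s|] //= [<-] /=.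
  have [[x Ex] [y Ey]] := IH1 _ _ E; split.
    exists (sh [:: false] (Delta t0) * sh [:: true] x * delta (phi t1)).
    by rewrite Ex shM !mulgA -sh01C sh_D.
  (* Evaluating both sides of [Ey] on [t1] shows that [y] carries [phi t1] to [phi s]; [delta_act]
     can then move it across [delta]. *)
  exists y; have yP : act (phi t1) y = Some (phi s).
    have : act t1 (Dgen a * Delta s) = Some (phi s).
      by rewrite actM act_D E /= act_Delta.
    by rewrite Ey actM act_Delta.
  rewrite -!mulgA -(delta_act yP) -(sh_D [:: true]) [LHS]mulgA sh01C -!mulgA.
  by congr (_ * _); rewrite !mulgA -!shM Ey.
- case E: (actD t0 a) => [s|] //= [<-] /=.
  have [[x Ex] [y Ey]] := IH0 _ _ E; split.
    by exists (sh [:: false] x * sh [:: true] (Delta t1) * delta (phi t1));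
      rewrite Ex shM !mulgA sh_D.
  have [z Ez] := delta_sh0 (phi t1) y; exists z.
  rewrite -(sh_D [:: false]) !mulgA -shM Ey -!mulgA -Ez shM.
  by rewrite -!mulgA [in RHS](mulgA (sh [:: true] _)) sh01C -!mulgA.
Qed.

Lemma Delta_act t x t' : act t x = Some t' ->
  exists y, x * Delta t' = Delta t * y.
Proof.
elim/LDmon_ind: x t => [|a x IH] t.
  by rewrite act1 => -[->]; exists 1; rewrite mul1g mulg1.
move=> /act_mulP[s]; rewrite act_D => /Delta_actD[_ [y Ey]] /IH[z Ez].
by exists (y * z); rewrite -mulgA Ez mulgA Ey mulgA.
Qed.

Lemma leaves_nontrivial (t s : LDcat) (f : Hom t s) :
  leaves t < leaves s -> nontrivial f.
Proof. by move=> ts fid; case: fid ts => u; rewrite ltnn. Qed.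

Lemma LDDelta_Garside : left_Garside_map (C := LDcat) LDDelta.
Proof.
split=> [t s f /LD_nontrivial[a [x fx]] | t s f _].
  have : act t (Dgen a * x) = Some s by rewrite -fx; exact/eqP/(valP f).
  move=> /act_mulP[u tu _]; have au := tu; rewrite act_D in au.
  exists u, (LDmor tu).
  split; first exact/leaves_nontrivial/(actD_leaves au).
    by apply/LD_ldivP; exists x.
  have [[y Ey] _] := Delta_actD au.
  by apply/LD_ldivP; exists y.
apply/LD_ldivP; have [y Ey] := Delta_act (eqP (valP f)).
by exists y.
Qed.

Lemma LD_left_Garside : left_Garside LDcat.
Proof.
split; first by split; [exact: LD_LG0 | exact: LD_LG1 | exact: LD_LG2].
exists phi, LDDelta; exact: LDDelta_Garside.
Qed.

(** * Braids *)

Definition Bcompl (i j : nat) : Binf :=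
  if i == j then 1
  else if (j == i.+1) || (i == j.+1) then sigma j * sigma i else sigma j.

Notation Bgrid := (grid Bcompl).
Notation Brel := (braid_rel (fun i : nat => i)).

Lemma Bcompl_xx i : Bcompl i i = 1.
Proof. by rewrite /Bcompl eqxx. Qed.

Lemma Bcompl_near i j : (j == i.+1) || (i == j.+1) ->
  Bcompl i j = sigma j * sigma i.
Proof. by move=> ij; rewrite /Bcompl ij ifF //; lia. Qed.

Lemma Bcompl_far i j : (i + 2 <= j) || (j + 2 <= i) -> Bcompl i j = sigma j.
Proof. by move=> ij; rewrite /Bcompl !ifF //; lia. Qed.

Lemma Bcompl_rel l r : Brel l r -> exists i j u v,
  [/\ l = i :: u, r = j :: v, pword Brel u = Bcompl i j & pword Brel v = Bcompl j i].
Proof.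
case=> i j ij; exists i, j.
- exists [:: j], [:: i]; split=> //; rewrite Bcompl_far //; lia.
- exists [:: j; i], [:: i; j].
  split=> //; rewrite Bcompl_near; try lia; exact: (pwordM Brel [:: _] [:: _]).
Qed.

Lemma Bcompl_square i j : sigma i * Bcompl i j = sigma j * Bcompl j i.
Proof.
have [->//|nij] := eqVneq i j.
have [ij|ij] := boolP ((j == i.+1) || (i == j.+1)).
  rewrite !Bcompl_near ?mulgA; [|lia..].
  by case/orP: ij => /eqP ->; rewrite sigma_braid.
have [ij'|ij'] : i + 2 <= j \/ j + 2 <= i by lia.
  by rewrite !Bcompl_far ?(sigma_comm ij') // ij' ?orbT.
by rewrite !Bcompl_far ?(sigma_comm ij') // ij' ?orbT.
Qed.

Lemma piD_cat c a : all id c ->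
  piD (c ++ a) = if all id a then sigma (size c + size a) else 1.
Proof. by rewrite /piD all_cat size_cat => ->. Qed.

Lemma piLD_word w : piLD (pword LD_rel w) = \prod_(a <- w) piD a.
Proof. exact: plift_word piD_respects w. Qed.

Lemma piD_0 c a : piD (c ++ false :: a) = 1.
Proof. by rewrite /piD all_cat /= andbF. Qed.

(** The prefix [c] of ones is carried along because [LDcompl] recurses under the letter 1, which
    raises the braid index. *)
Lemma prod_piD_LDcompl c a b : all id c ->
  \prod_(d <- LDcompl a b) piD (c ++ d) =
  if all id a && all id b then Bcompl (size c + size a) (size c + size b)
  else piD (c ++ b).
Proof.
elim: a b c => [|x a IH] [|y b] c cT.
- by rewrite big_nil Bcompl_xx.
- case: y b => [[|[] b]|b]; rewrite /= !big_cons big_nil mulg1 ?piD_0 ?mul1g.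
  + by rewrite !piD_cat //= Bcompl_near ?addn0 ?addn1 ?eqxx.
  + rewrite /= !piD_cat //=; case: ifP => // _; rewrite Bcompl_far //; lia.
  + by rewrite piD_cat.
  + by rewrite piD_cat.
- case: x a {IH} => [[|[] a]|a]; rewrite /= !big_cons big_nil mulg1 ?piD_0 ?mul1g.
  + by rewrite !piD_cat //= mulg1 Bcompl_near ?addn0 ?addn1 ?eqxx ?orbT.
  + rewrite !piD_cat //= andbT; case: ifP => // _; rewrite Bcompl_far //; lia.
  + by [].
  + by [].
- case: x y => [] [] /=.
  + rewrite big_map; have cT' : all id (rcons c true) by rewrite all_rcons.
    have := IH b _ cT'; rewrite size_rcons !addSnnS cat_rcons => <-.
    by apply: eq_bigr => d _; rewrite cat_rcons.
  + by rewrite big_cons big_nil mulg1 andbF.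
  + by rewrite big_cons big_nil mulg1.
  + by rewrite big_map big1 ?piD_0 // => d _; rewrite piD_0.
Qed.

Lemma piLD_LDC a b : piLD (LDC a b) =
  if all id a && all id b then Bcompl (size a) (size b) else piD b.
Proof. by rewrite piLD_word (prod_piD_LDcompl a b (c := [::])). Qed.

(** A square of two addresses on the rightmost branch maps to a braid square; otherwise one
    generator maps to 1 and the image is degenerate. *)
Lemma piLD_grid x y x' y' : LDgrid x y x' y' ->
  Bgrid (piLD x) (piLD y) (piLD x') (piLD y').
Proof.
apply: grid_morph => [|a b]; first exact: plift_is_morphism piD_respects.
rewrite !piLD_LDC !piLD_D /piD.
case: (all id a); case: (all id b) => /=; try exact: grid_1l; try exact: grid_1r.
exact: grid_gen.
Qed.

Lemma Bcompl_piLD i j : Bcompl i j = piLD (LDC (nseq i true) (nseq j true)).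
Proof. by rewrite piLD_LDC !all_nseq !orbT !size_nseq. Qed.

Lemma BcubeP i j k : cube Bcompl i j k.
Proof.
have [u [v [w [G1 G2 G3]]]] := LDcubeP (nseq i true) (nseq j true) (nseq k true).
exists (piLD u), (piLD v), (piLD w).
by split; rewrite !Bcompl_piLD; exact: piLD_grid.
Qed.

(** * Length and support of positive braids *)

Lemma repr_invariant (T : Type) (f : seq nat -> T) :
  (forall u l r v, Brel l r -> f (u ++ l ++ v) = f (u ++ r ++ v)) ->
  forall w, f (repr (pword Brel w)) = f w.
Proof.
by move=> fR w; apply: (cong_invariant fR); apply/pwordP; rewrite pword_repr.
Qed.

Definition blen (x : Binf) : nat := size (repr x).

Lemma blen_word w : blen (pword Brel w) = size w.
Proof. by apply: repr_invariant => u l r v [] *; rewrite !size_cat. Qed.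

Lemma blenM x y : blen (x * y) = blen x + blen y.
Proof.
by rewrite -[x]pword_repr -[y]pword_repr -pwordM !blen_word size_cat.
Qed.

Lemma blen_sigma i : blen (sigma i) = 1%N.
Proof. exact: blen_word. Qed.

Lemma Bgrid_lcm x y x' y' p q : Bgrid x y x' y' -> x * p = y * q ->
  exists r, p = y' * r /\ q = x' * r.
Proof.
move=> G E; pose bnd x n := blen x <= n.
have bM u v n : bnd (u * v) n -> bnd v n by rewrite /bnd blenM; lia.
have b0 i u : ~ bnd (sigma i * u) 0 by rewrite /bnd blenM blen_sigma.
have bS i u n : bnd (sigma i * u) n.+1 -> bnd u n.
  by rewrite /bnd blenM blen_sigma.
exact: (grid_lcm Bcompl_rel Bcompl_xx Bcompl_square bM b0 bS BcubeP G E
  (leqnn _)).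
Qed.

Definition letters_lt (n : nat) (x : Binf) : bool := all (fun i => i < n) (repr x).

Lemma letters_lt_word n w : letters_lt n (pword Brel w) = all (fun i => i < n) w.
Proof.
apply: (repr_invariant (f := all (fun i => i < n))) => u l r v lr.
rewrite !all_cat; congr (_ && (_ && _)).
by case: lr => i j _ /=; case: (i < n); case: (j < n).
Qed.

Lemma letters_ltM n x y : letters_lt n (x * y) = letters_lt n x && letters_lt n y.
Proof.
by rewrite -[x]pword_repr -[y]pword_repr -pwordM !letters_lt_word all_cat.
Qed.

Lemma Bincl_gen n (i : 'I_n.-1) : Bincl (pgen _ i) = sigma i.
Proof. exact: plift_gen (@Bincl_respects n) i. Qed.

Lemma BinclM n (x y : Bpos n) : Bincl (x * y) = Bincl x * Bincl y.
Proof. exact: gmulfM. Qed.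

Lemma piLDM x y : piLD (x * y) = piLD x * piLD y.
Proof. exact: gmulfM. Qed.

Lemma piLD1 : piLD 1 = 1.
Proof. exact: gmulf1. Qed.

(** The braid relations preserve the set of letters of a word, so any representative tests
    membership. For [n] equal to 0 or 1 the bound [n.-1] is 0 and only the unit passes. *)
Lemma inBP n b : inB n b <-> letters_lt n.-1 b.
Proof.
split=> [[a <-]|].
  elim/pword_ind: a => [|i a IH]; first by rewrite gmulf1 letters_lt_word.
  by rewrite BinclM letters_ltM IH Bincl_gen letters_lt_word /= ltn_ord.
elim/pword_ind: b => [|i b IH]; first by move=> _; exact: inB1.
rewrite letters_ltM letters_lt_word /= andbT => /andP[iltn /IH].
by apply: inBM; exists (pgen _ (Ordinal iltn)); rewrite Bincl_gen.
Qed.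

(** This makes divisibility in the braid category agree with divisibility in the infinite braid
    monoid. *)
Lemma inB_divr n u v : inB n (u * v) -> inB n v.
Proof. by move=> /inBP; rewrite letters_ltM => /andP[_ /inBP]. Qed.

Lemma inB_sigma n i : i < n.-1 -> inB n (sigma i).
Proof. by move=> ilt; apply/inBP; rewrite letters_lt_word /= ilt. Qed.

Lemma B_ldivP (n m p : Bcat) (f : Hom n m) (g : Hom n p) :
  ldiv f g <-> exists u, Bmid f * u = Bmid g.
Proof.
split=> [[h <-]|[u fu]]; first by exists (Bmid h).
have /andP[/eqP nm _] := valP f; have /andP[/eqP np /asboolP gB] := valP g.
have uB : (m == p) && `[< inB m u >].
  rewrite -nm -np eqxx; apply/asboolP/(@inB_divr _ (Bmid f)).
  by rewrite fu.
by exists (exist _ u uB); apply: val_inj.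
Qed.

(** * The functor to the braid category *)

Lemma actD_ht t a t' : actD t a = Some t' ->
  ht t' = ht t /\ inB (ht t) (piD a).
Proof.
(* Applying [D] at the address of i ones requires a rightmost branch of length at least i + 2. *)
move=> ta; suff [-> aB] : ht t' = ht t /\ (all id a -> size a < (ht t).-1).
  by split=> //; rewrite /piD; case: ifP => [/aB /inB_sigma|] // _; exact: inB1.
elim: t a t' ta => [i|t0 _ t1 IH] a t'; first by rewrite actD_Var.
case: a => [|[] a]; rewrite ?actD_Star0 ?actD_Star1.
- by case: t1 {IH} => [//|t1 t2] [<-].
- case E: (actD t1 a) => [s|] //= [<-] /=; have [-> H] := IH _ _ E.
  by split=> // /H; lia.
- by case E: (actD t0 a) => [s|] //= [<-].
Qed.

Lemma act_ht t x t' : act t x = Some t' -> ht t' = ht t /\ inB (ht t) (piLD x).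
Proof.
elim/LDmon_ind: x t => [|a x IH] t.
  by rewrite act1 => -[->]; rewrite piLD1; split=> //; exact: inB1.
move=> /act_mulP[s]; rewrite act_D => /actD_ht[st aB] /IH[-> sB].
by rewrite -st in aB *; rewrite piLDM piLD_D; split=> //; exact: inBM.
Qed.

Lemma piht_subproof (t t' : LDcat) (f : Hom t t') :
  (ht t == ht t') && `[< inB (ht t) (piLD (LDmid f)) >].
Proof.
have [-> fB] := act_ht (eqP (valP f)).
by rewrite eqxx; apply/asboolP.
Qed.

Definition piht_mor (t t' : LDcat) (f : Hom t t') : @Hom Bcat (ht t) (ht t') :=
  exist _ (piLD (LDmid f)) (piht_subproof f).

Lemma piht_mor1 (t : LDcat) : piht_mor (idm t) = idm (c := Bcat) (ht t).
Proof. by apply: val_inj; rewrite /= piLD1. Qed.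

Lemma piht_morM (t s u : LDcat) (f : Hom t s) (g : Hom s u) :
  piht_mor (mcomp f g) = mcomp (piht_mor f) (piht_mor g).
Proof. by apply: val_inj; rewrite /= piLDM. Qed.

Definition piht : functor LDcat Bcat := Functor piht_mor1 piht_morM.

(** * Surjectivity and preservation of right-lcms *)

Fixpoint right_comb (n : nat) : term :=
  if n is n'.+1 then Star (Var 0) (right_comb n') else Var 0.

Lemma ht_right_comb n : ht (right_comb n) = n.
Proof. by elim: n => //= n ->. Qed.

Lemma actD_nseq t i : i < (ht t).-1 -> exists t', actD t (nseq i true) = Some t'.
Proof.
elim: i t => [|i IH] [j|t0 t1] //=; first by case: t1 => // t1 t2 _; eexists.
move=> ilt; have [|s Es] := IH t1; first by lia.
by exists (Star t0 s); rewrite actD_Star1 Es.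
Qed.

(** A generator with index allowed by the height always lifts to the rightmost branch, and the
    action keeps the height, so a braid word lifts letter by letter. *)
Lemma act_lift t b : letters_lt (ht t).-1 b ->
  exists x t', act t x = Some t' /\ piLD x = b.
Proof.
elim/pword_ind: b t => [|i b IH] t.
  by move=> _; exists 1, t; rewrite act1 piLD1.
rewrite letters_ltM letters_lt_word /= andbT => /andP[/actD_nseq[s ts]].
have [<- _] := actD_ht ts; move=> /IH[x [t' [sx xb]]].
exists (Dgen (nseq i true) * x), t'; rewrite actM act_D ts; split=> //.
by rewrite piLDM piLD_D xb /piD all_nseq orbT size_nseq.
Qed.

Lemma pack_Bcat (n m n' m' : Bcat) (f : Hom n m) (g : Hom n' m') :
  n = n' -> m = m' -> Bmid f = Bmid g -> pack f = pack g.
Proof. by move=> nn mm; subst=> fg; congr pack; exact: val_inj. Qed.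

Lemma piht_surjective : surjective_functor piht.
Proof.
split=> [n|n m g]; first by exists (right_comb n); exact: ht_right_comb.
have /andP[/eqP nm /asboolP/inBP gB] := valP g.
have tn := ht_right_comb n.
have [|x [t' [tx xg]]] := @act_lift (right_comb n) (Bmid g); first by rewrite tn.
exists (right_comb n), t', (LDmor tx); apply: pack_Bcat => //.
by rewrite -[LHS]/(ht t') (act_ht tx).1 tn.
Qed.

Lemma piht_right_lcm : right_lcm_preserving piht.
Proof.
move=> t s s' w f g h [fgh h_lcm].
(* The image of [h] is compared with that of the lcm [h'] read off a grid: [h] divides [h'], and the
   image of the grid makes the image of [h'] divide every common multiple. *)
have [x' [y' [w' [h' [G Eh']]]]] := LD_common_multiple_grid fgh.
have [/h_lcm/LD_ldivP[e Ee] _] := LDgrid_right_lcm G Eh'.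
case: fgh => /LD_ldivP[p Ep] /LD_ldivP[q Eq].
split.
  split; apply/B_ldivP.
    by exists (piLD p); rewrite -[RHS]/(piLD (LDmid h)) -Ep piLDM.
  by exists (piLD q); rewrite -[RHS]/(piLD (LDmid h)) -Eq piLDM.
move=> m k [/B_ldivP[a fa] /B_ldivP[b gb]].
have [r [Er _]] := Bgrid_lcm (piLD_grid G) (etrans fa (esym gb)).
apply/B_ldivP; exists (piLD e * r).
have Ehe : piLD (LDmid h) * piLD e = piLD (LDmid f) * piLD y'.
  by rewrite -!piLDM Ee Eh'.
by rewrite -fa Er [RHS](mulgA (piLD (LDmid f))) -Ehe mulgA.
Qed.

Theorem theorem6p1 :
  left_Garside LDcat /\
  left_Garside_map (C := LDcat) LDDelta /\
  exists F : functor LDcat Bcat,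
    (forall t : term, F t = ht t) /\
    (forall (t t' : term) (f : LDhom t t'),
       Bmid (fmor F (f : @Hom LDcat t t')) = piLD (LDmid f)) /\
    surjective_functor F /\
    right_lcm_preserving F.
Proof.
split; first exact: LD_left_Garside.
split; first exact: LDDelta_Garside.
exists piht; split=> //; split=> //.
by split; [exact: piht_surjective | exact: piht_right_lcm].
Qed.
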